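(* For each cardinal $\kappa$ let $\boldsymbol{A}_\kappa$ be the Heyting algebra obtained by adding a new maximum $1$ to the powerset lattice of $\kappa$. For every $\kappa\in\mathbb{N}\cup\{\omega\}$: (i) the variety $\mathbb{V}(\boldsymbol{A}_\kappa)$ has a congruence preserving Beth companion; (ii) the variety $\mathbb{V}(\boldsymbol{A}_\kappa)$ has a simple Beth companion if and only if $\kappa\in\{0,1,2,\omega\}$.
   Context: **The algebras $\boldsymbol{A}_\kappa$.** $\boldsymbol{A}_\kappa$ is the unique Heyting algebra whose lattice reduct is obtained by adding a new maximum $1$ to $\langle\mathcal{P}(\kappa);\cap,\cup\rangle$. Its implication is: $a\to b=1$ if $a\leq b$; $a\to b=b$ if $a=1$; $a\to b=(\kappa- a)\cup b$ if $a,b\in\mathcal{P}(\kappa)$ and $a\nleq b$. $\mathbb{N}$ contains $0$; $\mathbb{V}(\boldsymbol{A})$ is the variety generated by $\boldsymbol{A}$. **Implicit operations.** Let $\mathsf{K}$ be a class of algebras in a language $\mathscr{L}_{\mathsf{K}}$. An $n$-ary partial function on $\mathsf{K}$ is a sequence $f=\langle f^{\boldsymbol{A}}:\boldsymbol{A}\in\mathsf{K}\rangle$ where each $f^{\boldsymbol{A}}$ is a function from a subset $\mathsf{dom}(f^{\boldsymbol{A}})\subseteq A^n$ to $A$. A first order formula $\varphi(x_1,\dots,x_n,y)$ with $n\geq 1$ is functional in $\mathsf{K}$ when for all $\boldsymbol{A}\in\mathsf{K}$ and $a_1,\dots,a_n\in A$ there is at most one $b\in A$ with $\boldsymbol{A}\vDash\varphi(a_1,\dots,a_n,b)$;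 it then defines the partial function on $\mathsf{K}$ sending $\langle a_1,\dots,a_n\rangle$ to that $b$, when $b$ exists. An implicit operation of $\mathsf{K}$ is a partial function $f$ on $\mathsf{K}$ that is defined by some formula and is preserved by homomorphisms: for each homomorphism $h\colon\boldsymbol{A}\to\boldsymbol{B}$ with $\boldsymbol{A},\boldsymbol{B}\in\mathsf{K}$ and $\langle a_1,\dots,a_n\rangle\in\mathsf{dom}(f^{\boldsymbol{A}})$ one has $\langle h(a_1),\dots,h(a_n)\rangle\in\mathsf{dom}(f^{\boldsymbol{B}})$ and $h(f^{\boldsymbol{A}}(a_1,\dots,a_n))=f^{\boldsymbol{B}}(h(a_1),\dots,h(a_n))$. It is extendable when for all $\boldsymbol{A}\in\mathsf{K}$ and $a_1,\dots,a_n\in A$ there is $\boldsymbol{B}\in\mathsf{K}$ with $\boldsymbol{A}\leq\boldsymbol{B}$ and $\langle a_1,\dots,a_n\rangle\in\mathsf{dom}(f^{\boldsymbol{B}})$. A pp formula is a formula $\exists\vec z\,\psi$ with $\psi$ a finite conjunction of equations. $\mathsf{ext}_{pp}(\mathsf{K})$ is the class of extendable implicit operations of $\mathsf{K}$ that can be defined by a pp formula. **pp expansions.** For $\mathcal{F}\subseteq\mathsf{ext}_{pp}(\mathsf{K})$, let $\mathscr{L}_{\mathcal{F}}$ be obtained from $\mathscr{L}_{\mathsf{K}}$ by adding a new function symbol of the arity of $f$ for each $f\in\mathcal{F}$. Let $\mathsf{K}[\mathscr{L}_{\mathcal{F}}]$ be the class of all expansions $\boldsymbol{A}[\mathscr{L}_{\mathcal{F}}]$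 of those $\boldsymbol{A}\in\mathsf{K}$ for which $f^{\boldsymbol{A}}$ is total for every $f\in\mathcal{F}$, the new symbol for $f$ being interpreted as $f^{\boldsymbol{A}}$. A pp expansion of $\mathsf{K}$ is a class of the form $\mathbb{S}(\mathsf{K}[\mathscr{L}_{\mathcal{F}}])$ (subalgebras of members of $\mathsf{K}[\mathscr{L}_{\mathcal{F}}]$) for some $\mathcal{F}\subseteq\mathsf{ext}_{pp}(\mathsf{K})$. It is simple when it is of the form $\mathsf{K}[\mathscr{L}_{\mathcal{F}}]$ for some $\mathcal{F}\subseteq\mathsf{ext}_{pp}(\mathsf{K})$. A pp expansion of a quasivariety is a quasivariety. **Congruence preservation.** For a quasivariety $\mathsf{K}$, $\mathsf{Con}_{\mathsf{K}}(\boldsymbol{A})=\{\theta\in\mathsf{Con}(\boldsymbol{A}):\boldsymbol{A}/\theta\in\mathsf{K}\}$. A pp expansion $\mathsf{M}$ of a quasivariety $\mathsf{K}$ is congruence preserving when $\mathsf{Con}_{\mathsf{M}}(\boldsymbol{A})=\mathsf{Con}_{\mathsf{K}}(\boldsymbol{A}{\upharpoonright}_{\mathscr{L}_{\mathsf{K}}})$ for every $\boldsymbol{A}\in\mathsf{M}$. **Beth companions.** A class $\mathsf{M}$ has the strong Beth definability property when every implicit operation $f$ of $\mathsf{M}$ is interpolated by a set of terms, i.e., there is a set $T$ of terms such that for all $\boldsymbol{A}\in\mathsf{M}$ and $\vec a\in\mathsf{dom}(f^{\boldsymbol{A}})$ there is $t\in T$ with $f^{\boldsymbol{A}}(\vec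 a)=t^{\boldsymbol{A}}(\vec a)$. A Beth companion of a quasivariety $\mathsf{K}$ is a pp expansion $\mathsf{M}$ of $\mathsf{K}$ with the strong Beth definability property; equivalently (for pp expansions of quasivarieties), $\mathsf{M}$ has the strong epimorphism surjectivity property: whenever $\boldsymbol{A}\leq\boldsymbol{B}\in\mathsf{M}$ and $b\in B- A$, there are $\boldsymbol{C}\in\mathsf{M}$ and homomorphisms $g,h\colon\boldsymbol{B}\to\boldsymbol{C}$ with $g{\upharpoonright}_A=h{\upharpoonright}_A$ and $g(b)\neq h(b)$. A simple Beth companion is a Beth companion that is a simple pp expansion. *)

(* Defs.v *)
From Corelib Require Import RelationClasses.
From mathcomp Require Import all_boot.
From mathcomp Require Import boolp classical_sets.

Set Implicit Arguments.
Unset Strict Implicit.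
Unset Printing Implicit Defensive.

Local Open Scope classical_set_scope.

Record language := Language { symb : Type; arity : symb -> nat }.

Record algebra (L : language) := Algebra {
  carrier :> Type;
  op : forall s : symb L, ('I_(arity s) -> carrier) -> carrier }.

Arguments op {L} a s _.

(* Classes are plain predicates rather than [set (algebra L)]: [set] is also
   used below to build carriers, and the two uses need different universes. *)
Definition class (L : language) := algebra L -> Prop.

Record member (L : language) (K : class L) := Member {
  member_alg :> algebra L;
  memberP : K member_alg }.

Definition homomorphism (L : language) (A B : algebra L) (h : A -> B) :=
  forall (s : symb L) (a : 'I_(arity s) -> A),
    h (op A s a) = op B s (fun i => h (a i)).

(* [A <= B] up to isomorphism: an injective homomorphism from A to B. *)
Definition embedding (L : language) (A B : algebra L) (h : A -> B) :=
  homomorphism h /\ injective h.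

Definition subalgebras (L : language) (K : class L) : class L :=
  fun A => exists (B : algebra L) (h : A -> B), K B /\ embedding h.

Inductive term (L : language) (V : Type) :=
| Var (v : V)
| App (s : symb L) (args : 'I_(arity s) -> term L V).

Fixpoint eval (L : language) (A : algebra L) (V : Type) (e : V -> A)
    (t : term L V) : A :=
  match t with
  | Var v => e v
  | App s args => op A s (fun i => eval e (args i))
  end.

(* [formula L V] has its free variables in V; a quantifier binds the variable
   [None] of [option V]. *)
Inductive formula (L : language) (V : Type) :=
| Feq (t u : term L V)
| Ftrue
| Ffalse
| Fand (p q : formula L V)
| For (p q : formula L V)
| Fimp (p q : formula L V)
| Fall (p : formula L (option V))
| Fex (p : formula L (option V)).

Definition extend (A V : Type) (e : V -> A) (b : A) : option V -> A :=
  fun v => if v is Some v' then e v' else b.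

Fixpoint sat (L : language) (A : algebra L) (V : Type) (e : V -> A)
    (p : formula L V) : Prop :=
  match p with
  | Feq t u => eval e t = eval e u
  | Ftrue => True
  | Ffalse => False
  | Fand p q => sat e p /\ sat e q
  | For p q => sat e p \/ sat e q
  | Fimp p q => sat e p -> sat e q
  | Fall p => forall b : A, sat (extend e b) p
  | Fex p => exists b : A, sat (extend e b) p
  end.

Fixpoint equation_conjunction (L : language) (V : Type) (p : formula L V) :=
  match p with
  | Feq _ _ | Ftrue => true
  | Fand p q => equation_conjunction p && equation_conjunction q
  | _ => false
  end.

Fixpoint pp_formula (L : language) (V : Type) (p : formula L V) :=
  match p with
  | Fex p => pp_formula p
  | _ => equation_conjunction p
  end.

Definition variety (L : language) (K : class L) :=
  exists E : term L nat -> term L nat -> Prop,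
    forall A : algebra L,
      K A <-> forall t u, E t u -> forall e : nat -> A, eval e t = eval e u.

Definition generated_variety (L : language) (A : algebra L) : class L :=
  fun B => forall K : class L, variety K -> K A -> K B.

Section Quotient.
Variables (L : language) (A : algebra L) (r : A -> A -> Prop).

Definition congruence :=
  Equivalence r /\
  forall (s : symb L) (a b : 'I_(arity s) -> A),
    (forall i, r (a i) (b i)) -> r (op A s a) (op A s b).

Definition quotient_carrier := {C : A -> Prop | exists a, C = r a}.

Definition quotient_class (a : A) : quotient_carrier :=
  exist _ (r a) (ex_intro _ a erefl).

Definition quotient_repr (C : quotient_carrier) : A :=
  projT1 (cid (proj2_sig C)).

(* The operations are computed on chosen representatives, which is only
   meaningful when r is a congruence. *)
Definition quotient : algebra L :=
  @Algebra L quotient_carrier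
    (fun s c => quotient_class (op A s (fun i => quotient_repr (c i)))).
End Quotient.

Definition relative_congruence (L : language) (K : class L) (A : algebra L)
    (r : A -> A -> Prop) :=
  congruence r /\ K (quotient r).

Definition pfun (L : language) (K : class L) (n : nat) :=
  forall A : member K, ('I_n -> A) -> option A.

(* In [formula L (option 'I_n)] the variable [Some i] is x_(i+1) and [None]
   is y. As [f A a] has at most one value, this forces p to be functional
   in K. *)
Definition defines (L : language) (K : class L) (n : nat)
    (p : formula L (option 'I_n)) (f : pfun K n) :=
  forall (A : member K) (a : 'I_n -> A) (b : A),
    f A a = Some b <-> sat (extend a b) p.

Definition preserved_by_homs (L : language) (K : class L) (n : nat)
    (f : pfun K n) :=
  forall (A B : member K) (h : A -> B), homomorphism h ->
  forall (a : 'I_n -> A) (b : A),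
    f A a = Some b -> f B (fun i => h (a i)) = Some (h b).

Definition implicit_operation (L : language) (K : class L) (n : nat)
    (f : pfun K n) :=
  [/\ 0 < n, exists p, defines p f & preserved_by_homs f].

Definition extendable (L : language) (K : class L) (n : nat) (f : pfun K n) :=
  forall (A : member K) (a : 'I_n -> A),
    exists (B : member K) (h : A -> B),
      embedding h /\ exists b, f B (fun i => h (a i)) = Some b.

Definition ext_pp (L : language) (K : class L) (n : nat) (f : pfun K n) :=
  [/\ implicit_operation f, extendable f
    & exists p, pp_formula p /\ defines p f].

Definition expand (L : language) (I : Type) (ar : I -> nat) : language :=
  @Language (symb L + I)%type
    (fun s => match s with inl s => arity s | inr i => ar i end).

Definition reduct (L : language) (I : Type) (ar : I -> nat)
    (A : algebra (expand L ar)) : algebra L :=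
  @Algebra L (carrier A) (fun s => op A (inl s)).

(* A set of members of ext_pp(K), listed without repetition by the type I of
   the new function symbols. *)
Definition pp_family (L : language) (K : class L) (I : Type) (ar : I -> nat)
    (F : forall i, pfun K (ar i)) :=
  (forall i, ext_pp (F i)) /\
  injective (fun i => existT (pfun K) (ar i) (F i)).

(* K[L_F] *)
Definition expansions (L : language) (K : class L) (I : Type) (ar : I -> nat)
    (F : forall i, pfun K (ar i)) : class (expand L ar) :=
  fun A => exists KA : K (reduct A),
    forall (i : I) (a : 'I_(ar i) -> A),
      F i (Member KA) a = Some (op A (inr i) a).

Definition pp_expansion (L : language) (K : class L) (I : Type)
    (ar : I -> nat) (M : class (expand L ar)) :=
  exists F : forall i, pfun K (ar i),
    pp_family F /\ M = subalgebras (expansions F).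

Definition simple_pp_expansion (L : language) (K : class L) (I : Type)
    (ar : I -> nat) (M : class (expand L ar)) :=
  pp_expansion K M /\
  exists F : forall i, pfun K (ar i), pp_family F /\ M = expansions F.

Definition congruence_preserving (L : language) (K : class L) (I : Type)
    (ar : I -> nat) (M : class (expand L ar)) :=
  forall A : algebra (expand L ar), M A ->
  forall r : A -> A -> Prop,
    relative_congruence M r <-> relative_congruence K (A := reduct A) r.

Definition strong_Beth (L : language) (M : class L) :=
  forall (n : nat) (f : pfun M n), implicit_operation f ->
  exists T : term L 'I_n -> Prop,
    forall (A : member M) (a : 'I_n -> A) (b : A),
      f A a = Some b -> exists2 t, T t & b = eval a t.

Definition Beth_companion (L : language) (K : class L) (I : Type)
    (ar : I -> nat) (M : class (expand L ar)) :=
  pp_expansion K M /\ strong_Beth M.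

Definition simple_Beth_companion (L : language) (K : class L) (I : Type)
    (ar : I -> nat) (M : class (expand L ar)) :=
  Beth_companion K M /\ simple_pp_expansion K M.

Inductive heyting_symb := Meet | Join | Imp | Bot | Top.

Definition heyting : language :=
  Language (fun s => match s with Meet | Join | Imp => 2 | Bot | Top => 0 end).

Section PowersetPlusTop.
Variable T : Type.

(* [Some x] is the subset x of T and [None] is the new maximum. *)
Definition pt_carrier := option (set T).

Definition pt_meet (a b : pt_carrier) : pt_carrier :=
  match a, b with
  | None, _ => b
  | _, None => a
  | Some x, Some y => Some (x `&` y)
  end.

Definition pt_join (a b : pt_carrier) : pt_carrier :=
  match a, b with
  | Some x, Some y => Some (x `|` y)
  | _, _ => None
  end.

Definition pt_imp (a b : pt_carrier) : pt_carrier :=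
  match a, b with
  | _, None => None
  | None, Some y => Some y
  | Some x, Some y => if `[< x `<=` y >] then None else Some (~` x `|` y)
  end.

Definition powerset_top : algebra heyting :=
  @Algebra heyting pt_carrier (fun s =>
    match s return ('I_(@arity heyting s) -> pt_carrier) -> pt_carrier with
    | Meet => fun a => pt_meet (a ord0) (a ord_max)
    | Join => fun a => pt_join (a ord0) (a ord_max)
    | Imp => fun a => pt_imp (a ord0) (a ord_max)
    | Bot => fun _ => Some set0
    | Top => fun _ => None
    end).
End PowersetPlusTop.

Inductive nat_or_omega := Fin (n : nat) | Omega.

Definition A_ (k : nat_or_omega) : algebra heyting :=
  match k with
  | Fin n => powerset_top 'I_n
  | Omega => powerset_top nat
  end.

(* Main.v *)
(* The leaves of the Kripke frame of [powerset_top T] are the points of T, and an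
   algebra of V(A_k) is separated by its homomorphisms to the algebras
   [powerset_top T], where T has k points if k is finite and is arbitrary if
   k = omega.  Let b be an element of B which any two homomorphisms agreeing
   on a finite tuple a send to the same element.  Each h : B -> [powerset_top T]
   partitions T into the cells of the points in the same members of h(a).
   Collapsing a filter at a leaf shows that h(b) is determined, up to the choice
   between T and 1, by a union of cells, and if h and h' can be amalgamated over
   a then the choice is the same for both.  So b is a term in a as soon as terms
   can recognize the h which amalgamate.  Over omega, a fibre product
   amalgamates h and h' whenever the same cells are nonempty, and for k <= 2
   this already forces equal cardinalities; hence no new operation is needed.
   For finite k >= 3 one needs a permutation of the points, that is, cells of
   equal cardinality, and the companion adds the operations sending x to T if x
   is a set of i points and to 1 otherwise, for 0 < i < k.
   Conversely, for k >= 3 every operation of ext_pp commutes with permutations of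
   the points, hence preserves {0, {p}, T - {p}, T, 1}.  In a simple companion it
   is total on this subalgebra seen as an abstract Heyting algebra, whose
   automorphism exchanges {p} and T - {p}.  Then no term sends the pair
   ({p}, T - {p}) of the square of A_k to (T, 1), although the operation
   recognizing singletons does. *)

Require Import Defs.
From mathcomp Require Import all_boot.
From mathcomp Require Import boolp classical_sets filter.

Set Implicit Arguments.
Unset Strict Implicit.
Unset Printing Implicit Defensive.

Local Open Scope classical_set_scope.

(** * Heyting terms and equational theories *)

Definition two (X : Type) (x y : X) : 'I_2 -> X :=
  fun i => if i == ord0 then x else y.

Lemma two_comp (X Y : Type) (f : X -> Y) x y :
  (fun i => f (two x y i)) = two (f x) (f y).
Proof. by apply: funext => i; rewrite /two; case: eqP. Qed.

Lemma ord1_eta (X : Type) (a : 'I_1 -> X) : a = fun=> a ord0.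
Proof. by apply: funext => i; rewrite ord1. Qed.

Definition nullary (X : Type) : 'I_0 -> X :=
  fun i => match notF (ltn_ord i) with end.

Lemma nullary_eta (X : Type) (a b : 'I_0 -> X) : a = b.
Proof. by apply: funext => -[]. Qed.

Section Terms.
Variables (I : Type) (ar : I -> nat).
Local Notation L := (expand heyting ar).

Section TermConstructors.
Variable V : Type.
Implicit Types t u : term L V.
Definition tmeet t u : term L V := @App L V (inl Meet) (two t u).
Definition tjoin t u : term L V := @App L V (inl Join) (two t u).
Definition timp t u : term L V := @App L V (inl Imp) (two t u).
Definition tbot : term L V := @App L V (inl Bot) (@nullary _).
Definition ttop : term L V := @App L V (inl Top) (@nullary _).
Definition tneg t := timp t tbot.
Definition tiff t u := tmeet (timp t u) (timp u t).
Definition tmeets (s : seq (term L V)) := foldr tmeet ttop s.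
Definition tjoins (s : seq (term L V)) := foldr tjoin tbot s.
End TermConstructors.

Section Operations.
Variable B : algebra L.
Definition bmeet (x y : B) : B := op B (inl Meet) (two x y).
Definition bjoin (x y : B) : B := op B (inl Join) (two x y).
Definition bimp (x y : B) : B := op B (inl Imp) (two x y).
Definition bbot : B := op B (inl Bot) (@nullary _).
Definition btop : B := op B (inl Top) (@nullary _).

Variables (V : Type) (e : V -> B).
Lemma eval_meet t u : eval e (tmeet t u) = bmeet (eval e t) (eval e u).
Proof. by rewrite /= (two_comp (eval e)). Qed.
Lemma eval_join t u : eval e (tjoin t u) = bjoin (eval e t) (eval e u).
Proof. by rewrite /= (two_comp (eval e)). Qed.
Lemma eval_imp t u : eval e (timp t u) = bimp (eval e t) (eval e u).
Proof. by rewrite /= (two_comp (eval e)). Qed.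
Lemma eval_bot : eval e (tbot V) = bbot.
Proof. by congr (op B _); apply: nullary_eta. Qed.
Lemma eval_top : eval e (ttop V) = btop.
Proof. by congr (op B _); apply: nullary_eta. Qed.
Lemma eval_iff t u :
  eval e (tiff t u) =
  bmeet (bimp (eval e t) (eval e u)) (bimp (eval e u) (eval e t)).
Proof. by rewrite eval_meet !eval_imp. Qed.
End Operations.

End Terms.

Section Renaming.
Variable L : language.

Fixpoint tmap (V W : Type) (f : V -> W) (t : term L V) : term L W :=
  match t with
  | Var v => Var L (f v)
  | App s args => App (fun i => tmap f (args i))
  end.

Lemma eval_tmap (A : algebra L) (V W : Type) (f : V -> W) (e : W -> A) t :
  eval e (tmap f t) = eval (e \o f) t.
Proof.
by elim: t => //= s args IH; congr (op A s); apply: funext => i; apply: IH.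
Qed.

Lemma hom_eval (A B : algebra L) (h : A -> B) (V : Type) (e : V -> A) t :
  homomorphism h -> h (eval e t) = eval (h \o e) t.
Proof.
move=> hh; elim: t => //= s args IH; rewrite hh.
by congr (op B s); apply: funext => i; apply: IH.
Qed.

Lemma hom_comp (A B C : algebra L) (g : B -> C) (h : A -> B) :
  homomorphism g -> homomorphism h -> homomorphism (g \o h).
Proof. by move=> hg hh s a; rewrite /= hh hg. Qed.

(** Varieties are given by equations over [nat]; finite support lets [models_eqs_any] rename
    variables of any type to indices in a list. *)
Lemma term_finite_support (V : Type) (t : term L V) :
  exists l : seq {classic V}, forall (A : algebra L) (e e' : V -> A),
    {in l, forall v, e v = e' v} -> eval e t = eval e' t.
Proof.
elim: t => [v|s args /choice[l Hl]].
  by exists [:: (v : {classic V})] => A e e' /(_ v); rewrite inE eqxx; apply.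
exists (flatten [seq l i | i <- enum 'I_(arity s)]) => A e e' ee' /=.
congr (op A s); apply: funext => i; apply: Hl => v vl; apply: ee'.
by apply/flattenP; exists (l i) => //; apply/map_f; rewrite mem_enum.
Qed.

Definition models_eqs_of (D B : algebra L) :=
  forall t u : term L nat, (forall e : nat -> D, eval e t = eval e u) ->
  forall e : nat -> B, eval e t = eval e u.

(** The equations valid in [D] axiomatize the least variety containing [D]. *)
Lemma generated_varietyE (D B : algebra L) :
  generated_variety D B <-> models_eqs_of D B.
Proof.
split=> [DB|DB K [E KE] /KE KD].
  pose E t u := forall e : nat -> D, eval e t = eval e u.
  pose K : class L := fun A => forall t u, E t u ->
    forall e : nat -> A, eval e t = eval e u.
  by apply: (DB K) => //; exists E.
by apply/KE => t u /KD; apply: DB.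
Qed.

Lemma models_eqs_refl (D : algebra L) : models_eqs_of D D.
Proof. by []. Qed.

Lemma models_eqs_any (D B : algebra L) (b0 : B) : models_eqs_of D B ->
  forall (V : Type) (t u : term L V),
  (forall e : V -> D, eval e t = eval e u) ->
  forall e : V -> B, eval e t = eval e u.
Proof.
move=> DB V t u tu e.
have [l Hl] := term_finite_support t; have [l' Hl'] := term_finite_support u.
pose s := l ++ l'; pose f (v : V) := index (v : {classic V}) s.
(* [b0] is only a default for the indices outside the joint support of [t] and [u]. *)
pose e' i := nth b0 [seq e v | v <- s] i.
have e'E v : v \in s -> e v = (e' \o f) v.
  move=> vs; rewrite /e' /= (nth_map v) ?index_mem // nth_index //.
rewrite (Hl _ e (e' \o f)) => [|v vl]; last by rewrite e'E// mem_cat vl.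
rewrite (Hl' _ e (e' \o f)) => [|v vl]; last by rewrite e'E// mem_cat vl orbT.
rewrite -(eval_tmap f e' t) -(eval_tmap f e' u); apply: DB => e''.
by rewrite !eval_tmap.
Qed.

(** A failing instance of an equation would still fail under one of the separating homomorphisms. *)
Lemma models_eqs_separated (D B : algebra L) :
  (forall x y : B, x <> y -> exists (D' : algebra L) (h : B -> D'),
    [/\ models_eqs_of D D', homomorphism h & h x <> h y]) ->
  models_eqs_of D B.
Proof.
move=> sep t u tu e; apply: contrapT => /sep[D' [h [DD' hh]]]; apply.
by rewrite !hom_eval //; apply: DD'.
Qed.

Lemma models_eqs_embedding (D A B : algebra L) (h : A -> B) :
  embedding h -> models_eqs_of D B -> models_eqs_of D A.
Proof.
move=> [hh hi] DB; apply: models_eqs_separated => x y xy.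
by exists B, h; split=> // /hi.
Qed.

Definition power (D : algebra L) (J : Type) : algebra L :=
  @Algebra L (J -> D) (fun s a j => op D s (fun i => a i j)).

Lemma power_proj (D : algebra L) (J : Type) (j : J) :
  homomorphism (fun x : power D J => x j).
Proof. by []. Qed.

Lemma eval_power (D : algebra L) (J V : Type) (e : V -> power D J) t j :
  eval e t j = eval (fun v => e v j) t.
Proof. by rewrite (hom_eval _ _ (@power_proj D J j)). Qed.

Lemma models_eqs_power (D D' : algebra L) (J : Type) :
  models_eqs_of D D' -> models_eqs_of D (power D' J).
Proof.
move=> DD'; apply: models_eqs_separated => x y xy.
have [j xyj] : exists j, x j <> y j.
  by apply: contrapT => H; apply: xy; apply: funext => j;
    apply: contrapT => xyj; apply: H; exists j.
by exists D', (fun x => x j).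
Qed.

Lemma models_eqs_image (D A B : algebra L) (h : A -> B) :
  homomorphism h -> (forall y, exists x, h x = y) ->
  models_eqs_of D A -> models_eqs_of D B.
Proof.
move=> hh /choice[g hg] DA t u tu e.
have -> : e = h \o (g \o e) by apply: funext => v /=; rewrite hg.
by rewrite -!(hom_eval (g \o e)) // (DA _ _ tu).
Qed.
End Renaming.

(** * Forcing in the powerset algebras *)

(* [powerset_top T] consists of the upsets of the poset [option T] with root
   [None] below the leaves [Some p]. *)
Definition force (T : Type) (w : option T) (x : pt_carrier T) : Prop :=
  match x, w with
  | None, _ => True
  | Some X, Some p => X p
  | Some X, None => False
  end.

Section Forcing.
Variable T : Type.
Implicit Types (x y : pt_carrier T) (w : option T) (p : T).

Lemma force_rootE x : force None x = (x = None).
Proof. by apply: propext; case: x. Qed.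

Lemma force_root w x : force None x -> force w x.
Proof. by case: x w => [X|] []. Qed.

Lemma force_ext x y : (forall w, force w x <-> force w y) -> x = y.
Proof.
case: x y => [X|] [Y|] H //=.
- by congr Some; apply/seteqP; split=> p /(H (Some p)).
- by have /= [_ []] := H None.
- by have /= [[]] := H None.
Qed.

Lemma force_meet w x y : force w (pt_meet x y) = (force w x /\ force w y).
Proof. by apply: propext; case: x y w => [X|] [Y|] [p|] //=; tauto. Qed.

Lemma force_join w x y : force w (pt_join x y) = (force w x \/ force w y).
Proof. by apply: propext; case: x y w => [X|] [Y|] [p|] //=; tauto. Qed.

Lemma force_bot w : force w (Some set0 : pt_carrier T) = False.
Proof. by case: w. Qed.

Lemma force_top w : force w (None : pt_carrier T) = True.
Proof. by []. Qed.

Lemma force_full p : force (Some p) (Some setT : pt_carrier T) = True.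
Proof. by []. Qed.

Lemma force_fullN : force None (Some setT : pt_carrier T) = False.
Proof. by []. Qed.

Lemma force_imp_leaf p x y :
  force (Some p) (pt_imp x y) = (force (Some p) x -> force (Some p) y).
Proof.
apply: propext; case: x y => [X|] [Y|] //=; last by split=> // ; apply.
case: asboolP => XY /=; first by split=> // _; apply: XY.
split=> [[]//|H]; have [Xp|] := pselect (X p); first by right; apply: H.
by left.
Qed.

Lemma force_imp_root x y :
  force None (pt_imp x y) = (forall w, force w x -> force w y).
Proof.
apply: propext; case: x y => [X|] [Y|] //=; last by split=> // /(_ None); apply.
case: asboolP => XY /=; first by split=> // _ [p|] //; apply: XY.
by split=> // H; apply: XY => p; apply: (H (Some p)).
Qed.

Definition forceE := (force_meet, force_join, force_bot, force_top, force_full,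
  force_fullN, force_imp_leaf, force_imp_root).

End Forcing.

(* The quotient of [powerset_top T] by the filter of the upsets containing the
   leaf p, as the subalgebra {0, 1} of [powerset_top T']. *)
Definition chi (T T' : Type) (p : T) (x : pt_carrier T) : pt_carrier T' :=
  if pselect (force (Some p) x) then None else Some set0.

Lemma force_chi (T T' : Type) (p : T) w x :
  force w (chi T' p x) = force (Some p) x.
Proof.
apply: propext; rewrite /chi; case: pselect => H; first by split.
by rewrite force_bot.
Qed.

(** Dual to the map of frames that extends [f] by sending root to root. *)
Definition pullback (T T' : Type) (f : T' -> T) (x : pt_carrier T) :
    pt_carrier T' := omap (fun X => f @^-1` X) x.

Lemma force_pullback (T T' : Type) (f : T' -> T) w x :
  force w (pullback f x) = force (omap f w) x.
Proof. by case: x w => [X|] [p|]. Qed.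

(** * Powerset algebras with operations recognizing sizes *)

Section SizedAlgebras.
Variables (I : Type) (sz : I -> forall T : Type, set T -> Prop).
Hypothesis sz0 : forall i T, ~ sz i (set0 : set T).
Local Notation L := (expand heyting (fun _ : I => 1)).

(** [sz] stays abstract so that one development covers both the plain Heyting algebras, with [I]
    empty, and the companion for finite k >= 3. *)
Definition sized (i : I) (T : Type) (x : pt_carrier T) : pt_carrier T :=
  if x is Some X then if pselect (sz i X) then Some setT else None else None.

Definition pt_alg (T : Type) : algebra L :=
  @Algebra L (pt_carrier T) (fun s =>
    match s return ('I_(@arity L s) -> pt_carrier T) -> pt_carrier T with
    | inl s => @op _ (powerset_top T) s
    | inr i => fun a => sized i (a ord0)
    end).

Lemma force_sized_leaf i T (p : T) x : force (Some p) (sized i x) = True.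
Proof. by apply: propext; case: x => //= X; case: pselect. Qed.

Lemma pt_homP (T T' : Type) (h : pt_alg T -> pt_alg T') :
  h None = None -> h (Some set0) = Some set0 ->
  {morph h : x y / pt_meet x y} -> {morph h : x y / pt_join x y} ->
  {morph h : x y / pt_imp x y} -> (forall i, {morph h : x / sized i x}) ->
  homomorphism h.
Proof. by move=> h1 h0 hM hJ hI hs [[]|i] a /=; rewrite ?hM ?hJ ?hI ?hs. Qed.

(** The values of [chi] are 1 and the empty set, and by [sz0] both are sent to 1 by [sized];
    conversely [sized i x] contains every leaf, so [chi] sends it to 1. *)
Lemma chi_hom (T T' : Type) (p : T) :
  homomorphism (chi T' p : pt_alg T -> pt_alg T').
Proof.
apply: pt_homP => [||x y|x y|x y|i x]; apply: (@force_ext T') => w.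
- by rewrite force_chi.
- by rewrite force_chi !force_bot.
- by rewrite force_chi !forceE !force_chi.
- by rewrite force_chi !forceE !force_chi.
- rewrite force_chi; case: w => [q|]; rewrite !forceE ?force_chi //.
  by split=> [H w|H]; [|have := H None]; rewrite !force_chi.
- rewrite force_chi force_sized_leaf /chi /sized.
  by case: pselect => //= _; case: pselect => // Hs; case: (sz0 Hs).
Qed.

(** At the root an implication is tested on all leaves; surjectivity makes every leaf of [T] visible
    from [T']. *)
Lemma pullback_hom (T T' : Type) (f : T' -> T) : (forall q, exists p, f p = q) ->
  (forall i X, sz i (f @^-1` X) <-> sz i X) ->
  homomorphism (pullback f : pt_alg T -> pt_alg T').
Proof.
move=> fsurj szf; apply: pt_homP => [||x y|x y|x y|i x]; apply: (@force_ext T') => w.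
- by [].
- by rewrite force_pullback !force_bot.
- by rewrite force_pullback !forceE !force_pullback.
- by rewrite force_pullback !forceE !force_pullback.
- rewrite force_pullback; case: w => [q|]; rewrite !forceE ?force_pullback //.
  split=> [H w|H w]; rewrite ?force_pullback; first exact: H.
  case: w => [q|]; last by have := H None; rewrite !force_pullback.
  by have [p <-] := fsurj q; have := H (Some p); rewrite !force_pullback.
- rewrite force_pullback /sized; case: x => //= X.
  by case: pselect => Hx; case: pselect => Hy; case: w => //=;
    move: Hx Hy; rewrite szf.
Qed.
End SizedAlgebras.

(** * Representation of the algebras in the variety *)

Section UltraFilterLogic.
Variables (J : Type) (U : set_system J).
Context {UU : UltraFilter U}.

Lemma ultra_imp (P Q : set J) : (U P -> U Q) <-> U [set v | P v -> Q v].
Proof.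
split=> [PQ|UPQ UP]; last by apply: (filterS2 _ _ UPQ UP) => v /=; apply.
have [/PQ|] := in_ultra_setVsetC P UU; first by apply: filterS => v Qv /= _.
by apply: filterS => v /=.
Qed.

Lemma ultra_or (P Q : set J) : U [set v | P v \/ Q v] <-> U P \/ U Q.
Proof.
split=> [UPQ|[]]; [|apply: filterS => v; by left|apply: filterS => v; by right].
have [|UnP] := in_ultra_setVsetC P UU; [by left|right].
by apply: (filterS2 _ _ UPQ UnP) => v [].
Qed.

Lemma ultra_and (P Q : set J) : U [set v | P v /\ Q v] <-> U P /\ U Q.
Proof.
split=> [UPQ|[UP UQ]]; last exact: filterI.
by split; apply: filterS UPQ => v [].
Qed.
End UltraFilterLogic.

Section Representation.
Variables (I : Type) (sz : I -> forall T : Type, set T -> Prop).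
Hypothesis sz0 : forall i T, ~ sz i (set0 : set T).
Local Notation L := (expand heyting (fun _ : I => 1)).

Section EvalForcing.
Variables (T V : Type) (e : V -> pt_alg sz T).

Lemma force_eval_meet w (t u : term L V) : force w (eval e (tmeet t u)) =
  (force w (eval e t) /\ force w (eval e u)).
Proof. by rewrite eval_meet -force_meet. Qed.
Lemma force_eval_join w (t u : term L V) : force w (eval e (tjoin t u)) =
  (force w (eval e t) \/ force w (eval e u)).
Proof. by rewrite eval_join -force_join. Qed.
Lemma force_eval_imp_root (t u : term L V) : force None (eval e (timp t u)) =
  forall w, force w (eval e t) -> force w (eval e u).
Proof. by rewrite eval_imp -force_imp_root. Qed.
Lemma force_eval_imp_leaf p (t u : term L V) :
  force (Some p) (eval e (timp t u)) =
  (force (Some p) (eval e t) -> force (Some p) (eval e u)).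
Proof. by rewrite eval_imp -force_imp_leaf. Qed.
Lemma force_eval_bot w : force w (eval e (tbot _ V)) = False.
Proof. by rewrite eval_bot -(force_bot w). Qed.
Lemma force_eval_top w : force w (eval e (ttop _ V)) = True.
Proof. by rewrite eval_top -(force_top w). Qed.
End EvalForcing.

Definition eval_forceE := (force_eval_meet, force_eval_join,
  force_eval_imp_root, force_eval_imp_leaf, force_eval_bot, force_eval_top).

Lemma force_tmeets (T V : Type) (e : V -> pt_alg sz T) w (J : eqType)
    (F : J -> term L V) (r : seq J) :
  force w (eval e (tmeets (map F r))) <->
  forall j, j \in r -> force w (eval e (F j)).
Proof.
elim: r => [|j r IH]; first by rewrite [tmeets _]/= force_eval_top.
rewrite [tmeets _]/= force_eval_meet IH; split=> [[Hj Hr] j'|H].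
  by rewrite inE => /orP[/eqP->//|/Hr].
by split=> [|j' j'r]; apply: H; rewrite inE ?eqxx ?j'r ?orbT.
Qed.

Lemma force_tjoins (T V : Type) (e : V -> pt_alg sz T) w (J : eqType)
    (F : J -> term L V) (r : seq J) :
  force w (eval e (tjoins (map F r))) <->
  exists2 j, j \in r & force w (eval e (F j)).
Proof.
elim: r => [|j r IH]; first by rewrite [tjoins _]/= force_eval_bot; split=> // -[].
rewrite [tjoins _]/= force_eval_join IH; split=> [[Hj|[j' j'r Hj']]|[j']].
- by exists j; rewrite ?inE ?eqxx.
- by exists j'; rewrite ?inE ?j'r ?orbT.
- by rewrite inE => /orP[/eqP->|j'r Hj']; [left|right; exists j'].
Qed.

Lemma force_tiff (T V : Type) (e : V -> pt_alg sz T) (t u : term L V) :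
  force None (eval e (tiff t u)) = (eval e t = eval e u).
Proof.
apply: propext; rewrite force_eval_meet !force_eval_imp_root.
split=> [[tu ut]|->//]; apply: force_ext => w.
by split; [apply: tu|apply: ut].
Qed.

Lemma hom_biff (B : algebra L) (T : Type) (h : B -> pt_alg sz T) (x y : B) :
  homomorphism h ->
  h x = h y <-> force None (h (bmeet (bimp x y) (bimp y x))).
Proof.
move=> hh.
have -> : bmeet (bimp x y) (bimp y x) = eval id (tiff (Var L x) (Var L y)).
  by rewrite eval_iff.
by rewrite (hom_eval _ _ hh) force_tiff.
Qed.

Section Algebra.
Variables (T : Type) (B : algebra L).
Local Notation D := (pt_alg sz T).
Hypothesis DB : models_eqs_of D B.

(** The elements of [B] serve as variables, so that the identity valuation turns an equation of [D]
    into a statement about them. *)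
Lemma pt_identity (t u : term L B) :
  (forall e : B -> D, eval e t = eval e u) -> eval id t = eval id u.
Proof. by move=> tu; apply: (models_eqs_any (bbot B) DB tu). Qed.

Lemma biff_refl (x : B) : bmeet (bimp x x) (bimp x x) = btop B.
Proof.
have /pt_identity : forall e : B -> D,
    eval e (tiff (Var _ x) (Var _ x)) = eval e (ttop _ B).
  move=> e; apply: force_ext => w; rewrite force_eval_top; split=> // _.
  by apply: force_root; rewrite force_tiff.
by rewrite eval_iff eval_top.
Qed.

Lemma bimp_top (x : B) : bimp (btop B) x = x.
Proof.
have /pt_identity : forall e : B -> D,
    eval e (timp (ttop _ B) (Var _ x)) = eval e (Var _ x).
  move=> e; apply: force_ext => -[p|]; rewrite eval_forceE.
    by rewrite force_eval_top; split=> // /(_ Logic.I).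
  split=> [/(_ None)|H w _]; first by rewrite force_eval_top; apply.
  exact: force_root.
by rewrite eval_imp eval_top.
Qed.

Lemma bmeet_top (x : B) : bmeet x (btop B) = x.
Proof.
have /pt_identity : forall e : B -> D,
    eval e (tmeet (Var _ x) (ttop _ B)) = eval e (Var _ x).
  move=> e; apply: force_ext => w; rewrite force_eval_meet force_eval_top.
  by split=> [[]|].
by rewrite eval_meet eval_top.
Qed.

Lemma bmeet_iff (x y : B) : bmeet x (bmeet (bimp x y) (bimp y x)) =
  bmeet y (bmeet (bimp x y) (bimp y x)).
Proof.
have /pt_identity : forall e : B -> D,
    eval e (tmeet (Var _ x) (tiff (Var _ x) (Var _ y))) =
    eval e (tmeet (Var _ y) (tiff (Var _ x) (Var _ y))).
  move=> e; apply: force_ext => -[p|].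
    by rewrite !force_eval_meet !force_eval_imp_leaf /=; tauto.
  by rewrite !force_eval_meet !force_eval_imp_root; split=> -[H [H1 H2]];
     do 2?split => //; [apply: H1|apply: H2].
by rewrite !eval_meet !eval_imp.
Qed.

Lemma biff_eq (x y : B) : bmeet (bimp x y) (bimp y x) = btop B -> x = y.
Proof. by move=> E; have := bmeet_iff x y; rewrite E !bmeet_top. Qed.

(** An entry of the operation tables of [B]; a homomorphism is a map preserving all entries. *)
Definition op_point := {classic {s : symb L & 'I_(arity s) -> B}}.
Definition op_value (x : op_point) : B := op B _ (projT2 x).
Definition preserves_at (v : B -> D) (x : op_point) :=
  v (op_value x) = op D _ (fun i => v (projT2 x i)).

(* If [c] were sent to 1 by every map preserving the operations at the finitely
   many points of [l], then the diagram of [l] would imply [c] in [D], because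
   the filters of [D] are kernels of the identity and of the maps [chi p]. *)
Lemma partial_hom (c : B) (l : seq op_point) : c <> btop B ->
  exists v : B -> D, v c <> None /\ forall x, x \in l -> preserves_at v x.
Proof.
move=> cT; apply: contrapT => Hno.
pose F (x : op_point) : term L B :=
  tiff (App (fun i => Var L (projT2 x i))) (Var L (op_value x)).
pose d := tmeets (map F l).
have FE (v : B -> D) x : force None (eval v (F x)) <-> preserves_at v x.
  by rewrite force_tiff /preserves_at /=; split=> ->.
have key (v : B -> D) : force None (eval v d) -> v c = None.
  move=> dv; apply: contrapT => vc; apply: Hno; exists v; split=> // x xl.
  by apply/FE; apply: ((force_tmeets _ _ _ _).1 dv).
have /pt_identity : forall e : B -> D,
    eval e (timp d (Var _ c)) = eval e (ttop _ B).
  move=> e; apply: force_ext => w; rewrite force_eval_top; split=> // _.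
  apply: force_root; rewrite force_eval_imp_root => -[p|]; last first.
    by move/key => /= ->.
  have hp := @chi_hom _ _ sz0 T T p; move=> dp.
  have := key (chi T p \o e); rewrite -(hom_eval e d hp) force_chi => /(_ dp).
  by move/(congr1 (force None)); rewrite force_chi => ->.
have dT : eval id d = btop B.
  rewrite /d; elim: (l) => [|x r IH]; first by rewrite [tmeets _]/= eval_top.
  by rewrite [tmeets _]/= eval_meet IH bmeet_top eval_iff; apply: biff_refl.
by rewrite eval_imp dT bimp_top eval_top.
Qed.

(** Compactness: by [partial_hom], the maps not sending [c] to 1 and preserving finitely many
    entries generate a proper filter, which extends to an ultrafilter. *)
Lemma ultra_hom (c : B) : c <> btop B -> exists U : set_system (B -> D),
  [/\ UltraFilter U, U [set v | v c <> None] &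
    forall (s : symb L) (a : 'I_(arity s) -> B),
      U [set v | v (op B s a) = op D s (fun i => v (a i))]].
Proof.
move=> cT.
pose F : set_system (B -> D) := [set S | exists l : seq op_point,
  forall v, v c <> None -> (forall x, x \in l -> preserves_at v x) -> S v].
have FF : ProperFilter F.
  split=> [[l Hl]|]; first by have [v [/Hl]] := partial_hom l cT.
  split=> [|P Q [l Hl] [l' Hl']|P Q PQ [l Hl]]; first by exists [::].
    exists (l ++ l') => v vc Hv; split.
      by apply: Hl => // x xl; apply: Hv; rewrite mem_cat xl.
    by apply: Hl' => // x xl; apply: Hv; rewrite mem_cat xl orbT.
  by exists l => v vc /(Hl v vc)/PQ.
have [U [UU FU]] := ultraFilterLemma FF.
exists U; split=> // [|s a]; apply: FU; first by exists [::].
exists [:: existT _ s a : op_point] => v _ /(_ (existT _ s a)).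
by rewrite inE eqxx; apply.
Qed.
End Algebra.

(** Since [T] is finite, the ultrafilter settles all leaves at once: each [z] has a limit value
    [h z], equal to [v z] for almost all [v]. Arities being finite, the operations pass to the
    limit. *)
Lemma finite_representation (T : finType) (B : algebra L) (x y : B) :
  models_eqs_of (pt_alg sz T) B -> x <> y ->
  exists2 h : B -> pt_alg sz T, homomorphism h & h x <> h y.
Proof.
move=> DB xy; have /(ultra_hom DB)[U [UU Uc Uop]] :
    bmeet (bimp x y) (bimp y x) <> btop B by move/(biff_eq DB).
pose h (z : B) : pt_alg sz T :=
  if pselect (U [set v | v z = None]) then None
  else Some [set q | U [set v | force (Some q) (v z)]].
have Uh z : U [set v | v z = h z].
  rewrite /h; case: pselect => // Uz.
  have Uz' : U [set v | v z <> None].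
    by have [/Uz|] := in_ultra_setVsetC [set v : B -> _ | v z = None] UU.
  have : U [set v | forall q, force (Some q) (v z) <->
                    U [set v' | force (Some q) (v' z)]].
    apply: filter_forall => q.
    have [Uq|Uq] := in_ultra_setVsetC [set v : B -> _ | force (Some q) (v z)] UU.
      by apply: filterS (Uq) => v.
    apply: filterS (Uq) => v nv; split=> // Uq'.
    by have [? []] := filter_ex (filterI Uq Uq').
  apply: (filterS2 _ _ Uz') => v vz vq /=.
  apply: force_ext => -[q|]; first exact: vq.
  by rewrite force_rootE; split=> // /vz.
have hh : homomorphism h.
  move=> s a.
  have Ua : U [set v | forall i, v (a i) = h (a i)].
    by apply: filter_forall => i; apply: Uh.
  have [v [<- [-> va]]] := filter_ex (filterI (Uh (op B s a)) (filterI (Uop s a) Ua)).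
  by congr (op _ s); apply: funext.
exists h => // hxy.
have [v [+ vc]] := filter_ex (filterI Uc (Uh (bmeet (bimp x y) (bimp y x)))).
by apply; rewrite vc -force_rootE -hom_biff.
Qed.
End Representation.

(** * Algebras without size operations, on frames of arbitrary size *)

Section UnsizedAlgebras.
Variables (I : Type) (sz : I -> forall T : Type, set T -> Prop).
Hypothesis noI : I -> False.
Local Notation L := (expand heyting (fun _ : I => 1)).

Let sz0 i T : ~ sz i (set0 : set T). Proof. by case: (noI i). Qed.

(* The ultraproduct along U of the algebras D indexed by the maps v, with
   elements seen as sets of sections p choosing a leaf in each factor. *)
Lemma omega_representation (T : Type) (t0 : T) (B : algebra L) (x y : B) :
  models_eqs_of (pt_alg sz T) B -> x <> y ->
  exists (T' : Type) (h : B -> pt_alg sz T'),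
    [/\ inhabited T', homomorphism h & h x <> h y].
Proof.
move=> DB xy; have /(ultra_hom sz0 DB)[U [UU Uc Uop]] :
    bmeet (bimp x y) (bimp y x) <> btop B by move/(biff_eq DB).
pose T' := (B -> pt_alg sz T) -> T.
pose at_ (v : B -> pt_alg sz T) (w : option T') : option T := omap (@^~ v) w.
pose h (z : B) : pt_alg sz T' :=
  if pselect (U [set v | force None (v z)]) then None
  else Some [set p : T' | U [set v | force (Some (p v)) (v z)]].
have Uh w z : force w (h z) = U [set v | force (at_ v w) (v z)].
  apply: propext; rewrite /h; case: pselect => Uz; last by case: w.
  by rewrite force_top; split=> // _; apply: filterS Uz => v; apply: force_root.
have UopE w s (a : 'I_(arity s) -> B) : force w (h (op B s a)) =
    U [set v | force (at_ v w) (op (pt_alg sz T) s (fun i => v (a i)))].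
  rewrite Uh; apply: propext; split=> Hw.
    by apply: (filterS2 _ _ (Uop s a) Hw) => v /= ->.
  by apply: (filterS2 _ _ (Uop s a) Hw) => v /= ->.
have hh : homomorphism h.
  move=> [[]|i] a; last by case: (noI i).
  - apply: force_ext => w; rewrite UopE /= force_meet !Uh.
    by rewrite -ultra_and; split; apply: filterS => v /=; rewrite ?force_meet.
  - apply: force_ext => w; rewrite UopE /= force_join !Uh.
    by rewrite -ultra_or; split; apply: filterS => v /=; rewrite ?force_join.
  - apply: force_ext => w; rewrite UopE /=; case: w => [p|].
      rewrite force_imp_leaf !Uh ultra_imp.
      by split; apply: filterS => v /=; rewrite force_imp_leaf.
    rewrite force_imp_root; split=> [Uimp w|H].
      rewrite !Uh ultra_imp; apply: filterS Uimp => v /=.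
      by rewrite force_imp_root; apply.
    have [//|Un] := in_ultra_setVsetC [set v : B -> pt_alg sz T |
      force None (pt_imp (v (a ord0)) (v (a ord_max)))] UU.
    (* [g] selects in each factor a world refuting the implication, if there is one. *)
    have /choice[g Hg] : forall v : B -> pt_alg sz T, exists w,
        ~ force None (pt_imp (v (a ord0)) (v (a ord_max))) ->
        force w (v (a ord0)) /\ ~ force w (v (a ord_max)).
      move=> v; have [Hv|Hv] := pselect (exists w,
        force w (v (a ord0)) /\ ~ force w (v (a ord_max))).
        by have [w Hw] := Hv; exists w.
      exists None; rewrite force_imp_root => Hn; exfalso; apply: Hn => w Hw.
      by apply: contrapT => Hw'; apply: Hv; exists w.
    (* The ultrafilter decides whether [g] mostly selects the root or mostly leaves; in the second
       case [t0] fills the negligible factors. *)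
    have [w Uw] : exists w : option T', U [set v | at_ v w = g v].
      have [UN|UN] := in_ultra_setVsetC [set v | g v = None] UU.
        by exists None; apply: filterS UN => v /= ->.
      exists (Some (fun v => odflt t0 (g v))); apply: filterS UN => v /=.
      by case: (g v).
    exfalso; have := H w; rewrite !Uh ultra_imp => Uw'.
    have [v [gv [Hv /=]]] := filter_ex (filterI Uw (filterI Uw' Un)).
    by move/Hg; rewrite -gv => -[/Hv].
  - apply: force_ext => w; rewrite UopE.
    by split=> [/filter_ex[v]|]; case: w.
  - apply: force_ext => w; rewrite UopE; split=> // _.
    exact: filterS filterT.
exists T', h; split=> //; first by split=> v.
move/(hom_biff _ _ hh); rewrite Uh => UN.
by have [v [/= Hv]] := filter_ex (filterI UN Uc); apply; rewrite -force_rootE.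
Qed.

(* A pullback along [f] commutes with an implication as soon as the range of
   [f] contains a witness of the failure of the inclusion. *)
Lemma pullback_op (T : Type) (s : symb L) (a : 'I_(arity s) -> pt_alg sz T) :
  exists l : seq {classic T}, forall (T' : Type) (f : T' -> T),
    (forall p, p \in l -> exists q, f q = p) ->
    pullback f (op (pt_alg sz T) s a) =
    op (pt_alg sz T') s (fun i => pullback f (a i)).
Proof.
case: s a => [[]|i] a; last by case: (noI i).
- exists [::] => T' f _; apply: force_ext => w.
  by rewrite force_pullback /= !force_meet !force_pullback.
- exists [::] => T' f _; apply: force_ext => w.
  by rewrite force_pullback /= !force_join !force_pullback.
- have [[p [Hp Hp']]|noP] := pselect (exists p, force (Some p) (a ord0) /\
      ~ force (Some p) (a ord_max)).
    exists [:: p] => T' f fp; apply: force_ext => -[q|].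
      by rewrite force_pullback /= !force_imp_leaf !force_pullback.
    have [|q fq] := fp p; first by rewrite inE.
    rewrite force_pullback /= !force_imp_root.
    split=> [/(_ (Some p))/(_ Hp)//|/(_ (Some q))].
    by rewrite !force_pullback /= fq => /(_ Hp).
  exists [::] => T' f _; apply: force_ext => -[q|].
    by rewrite force_pullback /= !force_imp_leaf !force_pullback.
  rewrite force_pullback /= !force_imp_root.
  split=> [H w|H w]; first by rewrite !force_pullback; apply: H.
  case: w => [p|]; last by have := H None; rewrite !force_pullback.
  by move=> Hp; apply: contrapT => Hp'; apply: noP; exists p.
- by exists [::].
- by exists [::].
Qed.

Lemma pullback_eval (T V : Type) (e : V -> pt_alg sz T) (t : term L V) :
  exists l : seq {classic T}, forall (T' : Type) (f : T' -> T),
    (forall p, p \in l -> exists q, f q = p) ->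
    pullback f (eval e t) = eval (pullback f \o e : V -> pt_alg sz T') t.
Proof.
elim: t => [v|s args /choice[l Hl]]; first by exists [::].
have [l' Hl'] := pullback_op (fun i => eval e (args i)).
exists (l' ++ flatten [seq l i | i <- enum 'I_(arity s)]) => T' f fl.
rewrite /= Hl' => [|p pl]; last by apply: fl; rewrite mem_cat pl.
congr (op (pt_alg sz T') s); apply: funext => i; apply: Hl => p pl; apply: fl.
rewrite mem_cat; apply/orP; right; apply/flattenP; exists (l i) => //.
by apply/map_f; rewrite mem_enum.
Qed.

(** Evaluating two terms involves finitely many witnesses, so a map from [nat] onto these carries
    the equation from [nat] to [T]. *)
Lemma models_eqs_omega (T : Type) (p0 : T) :
  models_eqs_of (pt_alg sz nat) (pt_alg sz T).
Proof.
move=> t u tu e; apply: force_ext => w.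
have [l Hl] := pullback_eval e t; have [l' Hl'] := pullback_eval e u.
(* The world to be tested comes first, so that [f 0] is this leaf when [w] is one. *)
pose s := odflt p0 w :: l ++ l' : seq {classic T}.
pose f i := nth (p0 : {classic T}) s i.
have fs p : p \in s -> exists i, f i = p.
  by move=> ps; exists (index p s); rewrite /f nth_index.
have : pullback f (eval e t) = pullback f (eval e u).
  rewrite Hl => [|p pl]; last by apply: fs; rewrite inE mem_cat pl orbT.
  by rewrite Hl' ?tu // => p pl; apply: fs; rewrite inE mem_cat pl !orbT.
move/(congr1 (force (omap (fun=> 0) w))); rewrite !force_pullback.
by case: w @s @f fs => [p|] s f fs /= ->.
Qed.
End UnsizedAlgebras.

(** * Interpolation by terms *)

Fixpoint tsubst (L : language) (V W : Type) (f : V -> term L W) (t : term L V) :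
    term L W :=
  match t with
  | Var v => f v
  | App s args => App (fun i => tsubst f (args i))
  end.

Lemma eval_tsubst (L : language) (A : algebra L) (V W : Type)
    (f : V -> term L W) (e : W -> A) t :
  eval e (tsubst f t) = eval (fun v => eval e (f v)) t.
Proof.
by elim: t => //= s args IH; congr (op A s); apply: funext => i; apply: IH.
Qed.

Lemma fullP (T : Type) (x : pt_carrier T) :
  x = Some setT <-> (forall p, force (Some p) x) /\ ~ force None x.
Proof.
split=> [->|[]]; first by split.
case: x => [X|] //= HX _.
by congr Some; apply/seteqP; split.
Qed.

(** The regular element with leaves [X], as produced by double negation: the full set becomes 1. *)
Definition regularization (T : Type) (X : set T) : pt_carrier T :=
  if pselect (X = setT) then None else Some X.

Lemma force_regularization_leaf (T : Type) (X : set T) p :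
  force (Some p) (regularization X) = X p.
Proof. by rewrite /regularization; case: pselect => /= [->|]. Qed.

Lemma force_regularization_root (T : Type) (X : set T) :
  force None (regularization X) <-> (forall p, X p).
Proof.
rewrite /regularization; case: pselect => /= [->//|H]; split=> // XT.
by apply: H; apply/seteqP; split.
Qed.

Section Interpolation.
Variables (I : Type) (sz : I -> forall T : Type, set T -> Prop).
Local Notation L := (expand heyting (fun _ : I => 1)).

Section Regular.
Variables (T V : Type) (e : V -> pt_alg sz T) (p0 : T).

Lemma force_neg_leaf p (t : term L V) :
  force (Some p) (eval e (tneg t)) = ~ force (Some p) (eval e t).
Proof. by rewrite force_eval_imp_leaf force_eval_bot. Qed.

Lemma force_neg_root (t : term L V) : force None (eval e (tneg t)) <->
  forall p, ~ force (Some p) (eval e t).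
Proof.
rewrite force_eval_imp_root; split=> [H p /H|H [p|]]; rewrite force_eval_bot //.
  exact: H.
by move/(force_root (Some p0)); apply: H.
Qed.

Lemma force_negneg_leaf p (t : term L V) :
  force (Some p) (eval e (tneg (tneg t))) <-> force (Some p) (eval e t).
Proof. by rewrite !force_neg_leaf; split=> [/contrapT//|Hp]; apply. Qed.

Lemma force_negneg_root (t : term L V) : force None (eval e (tneg (tneg t))) <->
  forall p, force (Some p) (eval e t).
Proof.
rewrite force_neg_root; split=> H p; last by rewrite force_neg_leaf; apply.
by have := H p; rewrite force_neg_leaf => /contrapT.
Qed.

Lemma eval_negneg (t : term L V) : eval e (tneg (tneg t)) =
  regularization [set p | force (Some p) (eval e t)].
Proof.
apply: force_ext => -[p|]; first by rewrite force_negneg_leaf force_regularization_leaf.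
by rewrite force_negneg_root force_regularization_root.
Qed.

(** The value is the full set if that of [t] is, and 1 otherwise: this separates the full set from
    1, which no leaf can do. *)
Definition tdns (t : term L V) := timp (tneg (tneg t)) t.

Lemma force_tdns_leaf p (t : term L V) : force (Some p) (eval e (tdns t)).
Proof. by rewrite force_eval_imp_leaf force_negneg_leaf. Qed.

Lemma force_tdns_root (t : term L V) :
  force None (eval e (tdns t)) <-> eval e t <> Some setT.
Proof.
rewrite force_eval_imp_root fullP; split=> [H [tp]|H [p|]].
- by apply; apply: (H None); rewrite force_negneg_root.
- by rewrite force_negneg_leaf.
- by rewrite force_negneg_root => tp; apply: contrapT => tN; apply: H.
Qed.
End Regular.

(** * Interpolation of an element determined by a tuple, over abstract coordinates *)

Section Interpolant.
Variables (B : algebra L) (k : nat) (a : 'I_k -> B) (b : B).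
Variables (Ix : Type) (pts : Ix -> Type).
Variable coord : forall i, (B -> pt_alg sz (pts i)) -> Prop.
Variables (N : nat) (probe : 'I_N -> term L unit).

Definition probed T (X : pt_carrier T) j :=
  eval (fun=> X : pt_alg sz T) (probe j) = Some setT.

Hypothesis pts_inhabited : forall i, inhabited (pts i).
Hypothesis coord_hom : forall i h, @coord i h -> homomorphism h.
Hypothesis coord_sep : forall x y : B,
  (forall i h, @coord i h -> h x = h y) -> x = y.
Hypothesis coord_chi : forall i h, @coord i h -> forall p i',
  @coord i' (chi (pts i') p \o h).
Hypothesis coord_agree : forall i g h, @coord i g -> @coord i h ->
  (forall l, g (a l) = h (a l)) -> g b = h b.
Hypothesis probe_complete : forall i (X : set (pts i)),
  (exists p, X p) -> (exists p, ~ X p) -> exists j, probed (Some X) j.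
(* The sets [prf = c] are the cells: two coordinates can be amalgamated when their
   cells look the same to the probes. *)
Hypothesis coord_amalgam : forall i h i' h', @coord i h -> @coord i' h' ->
  forall (prf : pts i -> {set 'I_k}) (prf' : pts i' -> {set 'I_k}),
  (forall c, [/\ (forall p, prf p <> c) -> (forall p, prf' p <> c),
    (forall p, prf p = c) -> (forall p, prf' p = c) &
    forall j, probed (regularization [set p | prf p = c]) j ->
              probed (regularization [set p | prf' p = c]) j]) ->
  exists i'' (f : pts i'' -> pts i) (f' : pts i'' -> pts i'),
    [/\ forall p, exists q, f q = p, forall p, exists q, f' q = p,
      forall q, prf (f q) = prf' (f' q), @coord i'' (pullback f \o h)
      & @coord i'' (pullback f' \o h')].

Section Coordinate.
Variables (i : Ix) (h : B -> pt_alg sz (pts i)).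
Definition profile (p : pts i) : {set 'I_k} :=
  [set l | `[< force (Some p) (h (a l)) >]].

Lemma in_profile p l : (l \in profile p) = `[< force (Some p) (h (a l)) >].
Proof. by rewrite inE. Qed.
End Coordinate.

Lemma profile_eq i (h : B -> pt_alg sz (pts i)) p i'
    (h' : B -> pt_alg sz (pts i')) p' l : profile h p = profile h' p' ->
  force (Some p) (h (a l)) = force (Some p') (h' (a l)).
Proof.
move=> pp'; have := in_profile h p l; rewrite pp' in_profile => E.
by apply: propext; split=> /asboolP; [rewrite -E|rewrite E] => /asboolP.
Qed.

Definition cell (c : {set 'I_k}) : term L 'I_k :=
  tmeets [seq (if l \in c then Var L l else tneg (Var L l)) | l <- enum 'I_k].

Lemma force_cell i (h : B -> pt_alg sz (pts i)) p c :
  force (Some p) (eval (h \o a) (cell c)) <-> profile h p = c.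
Proof.
rewrite force_tmeets; split=> [H|<- l _]; last first.
  by rewrite in_profile; case: asboolP => // Hl; rewrite force_neg_leaf.
apply/setP => l; rewrite in_profile; have := H l; rewrite mem_enum => /(_ isT).
by case: ifP => _; [move/asboolP|rewrite force_neg_leaf => /asboolF].
Qed.

Definition probe_index :=
  ('I_k + {set 'I_k} + {set 'I_k} + 'I_N * {set 'I_k})%type.

(** Being 1 says for the second kind of term that the cell is empty, and for the third that it
    contains all leaves. The last kind applies a probe to the regularization of the cell, the form
    needed by [coord_amalgam]. *)
Definition probe_term (x : probe_index) : term L 'I_k :=
  match x with
  | inl (inl (inl l)) => Var L l
  | inl (inl (inr c)) => tneg (cell c)
  | inl (inr c) => tneg (tneg (cell c))
  | inr (j, c) => tsubst (fun=> tneg (tneg (cell c))) (probe j)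
  end.

Definition ones i (h : B -> pt_alg sz (pts i)) : {set probe_index} :=
  [set x | `[< eval (h \o a) (probe_term x) = None >]].
Definition fulls i (h : B -> pt_alg sz (pts i)) : {set probe_index} :=
  [set x | `[< eval (h \o a) (probe_term x) = Some setT >]].

Lemma in_ones i (h : B -> pt_alg sz (pts i)) x :
  x \in ones h <-> eval (h \o a) (probe_term x) = None.
Proof. by rewrite inE; split=> /asboolP. Qed.

Lemma in_fulls i (h : B -> pt_alg sz (pts i)) x :
  x \in fulls h <-> eval (h \o a) (probe_term x) = Some setT.
Proof. by rewrite inE; split=> /asboolP. Qed.

(* If s.2 is nonempty, the value of this term at h is the full set if s is
   contained in the data [(ones h, fulls h)], and 1 otherwise. *)
Definition data_term (s : {set probe_index} * {set probe_index}) :=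
  timp (tmeets [seq probe_term x | x <- enum s.1])
       (tjoins [seq tdns (probe_term x) | x <- enum s.2]).

Lemma force_data_leaf i (h : B -> pt_alg sz (pts i)) s p : s.2 <> finset.set0 ->
  force (Some p) (eval (h \o a) (data_term s)).
Proof.
move/eqP/set0Pn => [x xs]; rewrite force_eval_imp_leaf => _.
by apply/force_tjoins; exists x; [rewrite mem_enum|apply: force_tdns_leaf].
Qed.

Lemma force_data_root i (h : B -> pt_alg sz (pts i)) s : s.2 <> finset.set0 ->
  force None (eval (h \o a) (data_term s)) <->
  ~ (s.1 \subset ones h /\ s.2 \subset fulls h).
Proof.
have [p0] := pts_inhabited i => s0; split=> [|H].
  rewrite force_eval_imp_root => /(_ None) H [s1 s2].
  have /force_tjoins[] : force None (eval (h \o a)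
      (tjoins [seq tdns (probe_term x) | x <- enum s.2])).
    apply: H; apply/force_tmeets => x; rewrite mem_enum => /(fintype.subsetP s1).
    by move/in_ones => ->.
  by move=> x; rewrite mem_enum => /(fintype.subsetP s2)/in_fulls/= + /(force_tdns_root _ p0).
rewrite force_eval_imp_root => -[p|].
  by have := @force_data_leaf i h s p s0; rewrite force_eval_imp_leaf.
move/force_tmeets => H1; apply/force_tjoins; apply: contrapT => H2; apply: H.
split; apply/fintype.subsetP => x xs.
  by apply/in_ones; rewrite -force_rootE; apply: H1; rewrite mem_enum.
apply/in_fulls; apply: contrapT => xf; apply: H2.
by exists x; rewrite ?mem_enum //; apply/force_tdns_root.
Qed.

(* Otherwise there is only one nonempty cell and h cannot be told from its
   collapse at a leaf, although the latter sends b to 1. *)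
Lemma fulls_neq0 i (h : B -> pt_alg sz (pts i)) :
  coord h -> h b = Some setT -> fulls h <> finset.set0.
Proof.
move=> hc hb F0; have [p0] := pts_inhabited i.
have noF x : eval (h \o a) (probe_term x) <> Some setT.
  by move/in_fulls; rewrite F0 inE.
have prf p : profile h p = profile h p0.
  (* A leaf with another profile makes the cell of [p0] nonempty and proper, so some probe of it is
     full, against [noF]. *)
  apply: contrapT => pp0; pose X := [set p | profile h p = profile h p0].
  have [||j Hj] := @probe_complete i X; [by exists p0|by exists p|].
  apply: (noF (inr (j, profile h p0))).
  rewrite /probe_term eval_tsubst.
  suff -> : eval (h \o a) (tneg (tneg (cell (profile h p0)))) = Some X by [].
  rewrite (eval_negneg _ p0) /regularization; case: pselect => [XT|nXT].
    exfalso; apply: pp0; have : [set: pts i] p by [].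
    by rewrite -XT /= force_cell.
  by congr Some; apply/seteqP; split=> q /=; rewrite force_cell.
have : h b = chi (pts i) p0 (h b).
  apply: (coord_agree hc (coord_chi hc p0 i)) => l.
  apply: force_ext => -[p|]; rewrite /= force_chi.
    by rewrite (profile_eq l (prf p)).
  split=> [/force_root//|Hp0]; apply: contrapT => Hl.
  apply: (noF (inl (inl (inl l)))); rewrite fullP; split=> // p.
  by rewrite (profile_eq l (prf p)).
by move/(congr1 (force None)); rewrite force_chi hb /= => ->.
Qed.

(** The inclusions of data provide the hypotheses of [coord_amalgam]. The amalgamated maps agree on
    [a], hence on [b], and pullback along a surjection reflects the full set. *)
Lemma full_transfer i (h : B -> pt_alg sz (pts i)) i' (h' : B -> pt_alg sz (pts i')) :
  coord h -> coord h' -> ones h \subset ones h' -> fulls h \subset fulls h' ->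
  h b = Some setT -> h' b = Some setT.
Proof.
move=> hc hc' /fintype.subsetP s1 /fintype.subsetP s2 hb.
have [p0] := pts_inhabited i; have [p0'] := pts_inhabited i'.
have ones_le x : eval (h \o a) (probe_term x) = None ->
    eval (h' \o a) (probe_term x) = None.
  by move/in_ones/s1/in_ones.
have fulls_le x : eval (h \o a) (probe_term x) = Some setT ->
    eval (h' \o a) (probe_term x) = Some setT.
  by move/in_fulls/s2/in_fulls.
have negnegE i0 (g : B -> pt_alg sz (pts i0)) (q0 : pts i0) c :
    eval (g \o a) (tneg (tneg (cell c))) =
    regularization [set p | profile g p = c].
  rewrite (eval_negneg _ q0); congr regularization.
  by apply/seteqP; split=> q /=; rewrite force_cell.
have [|i'' [f [f' [fsurj fsurj' ff' fc fc']]]] :=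
    coord_amalgam hc hc' (prf := profile h) (prf' := profile h').
  move=> c; split=> [H p|H|j].
  - have := ones_le (inl (inl (inr c))); rewrite -!force_rootE.
    rewrite /probe_term !(force_neg_root _ p0) (force_neg_root _ p0').
    move=> Hc /force_cell; apply: Hc => q /force_cell; exact: H.
  - have := ones_le (inl (inr c)); rewrite -!force_rootE.
    rewrite /probe_term !(force_negneg_root _ p0) (force_negneg_root _ p0').
    move=> Hc p; apply/force_cell; apply: Hc => q; exact/force_cell.
  - have := fulls_le (inr (j, c)); rewrite /= !eval_tsubst.
    by rewrite (negnegE _ _ p0) (negnegE _ _ p0').
have : pullback f (h b) = pullback f' (h' b).
  apply: (coord_agree fc fc') => l; apply: force_ext => w /=.
  rewrite !force_pullback; case: w => [q|] /=.
    by rewrite (profile_eq l (ff' q)).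
  split; first by rewrite !force_rootE; apply: (ones_le (inl (inl (inl l)))).
  (* Here [h' (a l)] is 1, so [h (a l)] contains every leaf; were it the full set, [fulls_le] would
     make [h' (a l)] the full set too. *)
  move=> H'; apply: contrapT => Hl.
  have /fulls_le : eval (h \o a) (probe_term (inl (inl (inl l)))) = Some setT.
    rewrite fullP; split=> // p; have [q <-] := fsurj p.
    by rewrite /= (profile_eq l (ff' q)); apply: force_root.
  by rewrite fullP => -[_]; apply.
rewrite hb => E; rewrite fullP; split=> [p|H].
  have [q <-] := fsurj' p.
  by have := congr1 (force (Some q)) E; rewrite !force_pullback /= => <-.
by have := congr1 (force None) E; rewrite !force_pullback /= => ->.
Qed.

(** The collapses at two leaves of equal profile agree on [a], hence on [b]. *)
Lemma leaf_transfer i (h : B -> pt_alg sz (pts i)) p i'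
    (h' : B -> pt_alg sz (pts i')) p' : coord h -> coord h' ->
  profile h p = profile h' p' -> force (Some p) (h b) = force (Some p') (h' b).
Proof.
move=> hc hc' pp'.
have : chi (pts i) p (h b) = chi (pts i) p' (h' b).
  apply: (coord_agree (coord_chi hc p i) (coord_chi hc' p' i)) => l.
  apply: force_ext => w; rewrite /= !force_chi.
  by rewrite (profile_eq l pp').
by move/(congr1 (force None)); rewrite !force_chi.
Qed.

(** By [leaf_transfer], [wt] has the same leaves as [b] and can only give 1 in place of the full
    set. The terms for [Dlt] correct this wherever [h b] is full, and [full_transfer] shows that
    they are 1 wherever [h b] is 1. *)
Lemma interpolant : exists t : term L 'I_k, b = eval a t.
Proof.
pose W : {set {set 'I_k}} := [set c | `[< exists i (h : B -> pt_alg sz (pts i)) p,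
  [/\ coord h, profile h p = c & force (Some p) (h b)] >]]%SET.
pose Dlt : {set {set probe_index} * {set probe_index}} :=
  [set s | `[< exists i (h : B -> pt_alg sz (pts i)),
  [/\ coord h, h b = Some setT & s = (ones h, fulls h)] >]]%SET.
pose wt := tneg (tneg (tjoins [seq cell c | c <- enum W])).
exists (tmeet wt (tmeets [seq data_term s | s <- enum Dlt])).
apply: coord_sep => i h hc; rewrite (hom_eval _ _ (coord_hom hc)).
have [p0] := pts_inhabited i.
have Dlt_neq0 s : s \in Dlt -> s.2 <> finset.set0.
  by rewrite inE => /asboolP[i' [h' [hc' hb' ->]]]; apply: fulls_neq0.
have WE p : force (Some p) (eval (h \o a)
    (tjoins [seq cell c | c <- enum W])) <-> force (Some p) (h b).
  rewrite force_tjoins; split=> [[c]|Hp]; last first.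
    exists (profile h p); last exact/force_cell.
    by rewrite mem_enum inE; apply/asboolP; exists i, h, p.
  rewrite mem_enum inE => /asboolP[i' [h' [p' [hc' pc' Hp']]]] /force_cell pc.
  by rewrite (leaf_transfer hc hc' (p' := p')) // pc pc'.
apply: force_ext => -[p|]; rewrite force_eval_meet.
  rewrite force_negneg_leaf WE; split=> [Hp|[]//]; split=> //.
  apply/force_tmeets => s; rewrite mem_enum => /Dlt_neq0.
  exact: force_data_leaf.
rewrite (force_negneg_root _ p0); split=> [Hb|[Hw HD]].
  split=> [p|]; first by rewrite WE; apply: force_root.
  apply/force_tmeets => s; rewrite mem_enum => sD.
  apply/force_data_root; first exact: Dlt_neq0.
  move: sD; rewrite inE => /asboolP[i' [h' [hc' hb' ->]]] [/= s1 s2].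
  have := full_transfer hc' hc s1 s2 hb'.
  by move: Hb; rewrite force_rootE => ->.
apply: contrapT => Hb; have hb : h b = Some setT.
  by apply/fullP; split=> // p; apply/WE.
have : (ones h, fulls h) \in Dlt by rewrite inE; apply/asboolP; exists i, h.
move=> sD; have := (force_tmeets _ _ _ _).1 HD (ones h, fulls h).
rewrite mem_enum => /(_ sD)/force_data_root[]; first exact: Dlt_neq0.
by split.
Qed.
End Interpolant.
End Interpolation.

(** * The strong Beth property *)

(** Both sides are the value of [f] at the common image of [a]. *)
Lemma beth_agree (L : language) (M : class L) (n : nat) (f : pfun M n)
    (A C : member M) (a : 'I_n -> A) (b : A) (g h : A -> C) :
  preserved_by_homs f -> f A a = Some b -> homomorphism g -> homomorphism h ->
  (forall l, g (a l) = h (a l)) -> g b = h b.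
Proof.
move=> fP fab hg hh gh; have := fP _ _ _ hg _ _ fab.
by rewrite (funext gh) (fP _ _ _ hh _ _ fab) => -[].
Qed.

Lemma strong_Beth_interpolant (L : language) (M : class L) :
  (forall (n : nat) (f : pfun M n) (A : member M) (a : 'I_n -> A) (b : A),
    preserved_by_homs f -> f A a = Some b ->
    exists t : term L 'I_n, b = eval a t) ->
  strong_Beth M.
Proof.
move=> HM n f [_ _ fP]; exists (fun=> True) => A a b fab.
by have [t bt] := HM _ _ _ _ _ fP fab; exists t.
Qed.

Definition set_card (T : finType) (X : set T) := #|[set p | `[< X p >]]%SET|.

(** Corresponding fibres are matched by position in their enumerations; this turns equal
    cardinalities into a permutation. *)
Lemma same_fibers (T P : finType) (u v : T -> P) :
  (forall c, set_card [set p | u p = c] = set_card [set p | v p = c]) ->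
  exists2 f : T -> T, injective f & forall q, u (f q) = v q.
Proof.
move=> uv; pose U c := enum [set p | u p == c]%SET.
pose V c := enum [set p | v p == c]%SET.
have UV c : size (U c) = size (V c).
  rewrite -!cardE; have := uv c; rewrite /set_card => E.
  transitivity #|[set p | `[< u p = c >]]%SET|.
    by apply: eq_card => p; rewrite !inE; apply/eqP/asboolP.
  rewrite [LHS]E; apply: eq_card => p; rewrite !inE.
  by apply/asboolP/eqP.
have mem_V q : q \in V (v q) by rewrite mem_enum inE.
pose f q := nth q (U (v q)) (index q (V (v q))).
have uf q : u (f q) = v q.
  have : f q \in U (v q) by rewrite mem_nth // UV index_mem.
  by rewrite mem_enum inE => /eqP.
exists f => // q q' ff'.
have vE : v q = v q' by rewrite -!uf ff'.
have : index q (V (v q)) = index q' (V (v q)).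
  apply/eqP; rewrite -(nth_uniq q (s := U (v q))) ?enum_uniq ?UV ?index_mem //.
    apply/eqP; rewrite -[LHS]/(f q) ff' /f -vE; apply: set_nth_default.
    by rewrite UV vE index_mem.
  by rewrite vE.
by move/(congr1 (nth q (V (v q)))); rewrite !nth_index // vE.
Qed.

Section StrongBeth.
Variables (I : Type) (sz : I -> forall T : Type, set T -> Prop).
Local Notation L := (expand heyting (fun _ : I => 1)).

Section Finite.
Hypothesis sz0 : forall i T, ~ sz i (set0 : set T).
Variables (n : nat) (N : nat) (probe : 'I_N -> term L unit).
Local Notation D := (pt_alg sz 'I_n.+1).
Hypothesis sz_bij : forall (f : 'I_n.+1 -> 'I_n.+1), injective f ->
  forall i X, sz i (f @^-1` X) <-> sz i X.
Hypothesis probe_card : forall X : set 'I_n.+1, (exists p, X p) ->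
  (exists p, ~ X p) -> exists2 j, probed sz probe (Some X) j &
  forall X' : set 'I_n.+1, probed sz probe (regularization X') j ->
    set_card X = set_card X'.
Variable M : class L.
Hypothesis M_eqs : forall A, M A -> models_eqs_of D A.
Hypothesis M_D : M D.

(** By [probe_card] the data fix the cardinality of every cell, so the cells of two coordinates with
    the same data differ by a permutation of the points, which is the amalgam. *)
Lemma finite_strong_Beth : strong_Beth M.
Proof.
apply: strong_Beth_interpolant => k f A a b fP fab.
pose coord (_ : unit) (h : A -> D) := homomorphism h.
apply: (@interpolant _ sz _ _ _ _ unit _ coord _ probe) => //.
- by split; exact: ord0.
- move=> x y xy; apply: contrapT => /(finite_representation sz0 (M_eqs (memberP A))).
  by case=> h hh; apply; apply: (xy tt).
- by move=> i h hh p i'; apply: hom_comp hh; apply: chi_hom.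
- by move=> i g h hg hh; apply: (beth_agree (C := Member M_D) fP fab).
- by move=> i X X1 X2; have [j Hj _] := probe_card X1 X2; exists j.
move=> i h i' h' hh hh' prf prf' H.
have [c|s sI Hs] := @same_fibers _ _ prf prf'.
  have [H0 H1 H2] := H c; set X := [set p | prf p = c].
  (* Empty cells and cells containing every point are settled by the first two clauses of [H]; the
     probes compare the others. *)
  have [X0|/forallNP X0] := pselect (exists p, X p); last first.
    have X0' := H0 X0; congr set_card; apply/seteqP.
    by split=> p /= => [/X0|/X0'].
  have [X1|/forallNP X1] := pselect (exists p, ~ X p); last first.
    have X1' p : prf p = c by apply: contrapT; exact: X1.
    by congr set_card; apply/seteqP; split=> p _ /=; [apply: H1|apply: X1'].
  have [j Xj] := probe_card X0 X1; apply; apply: H2.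
  have -> : regularization [set p | prf p = c] = Some X => //.
  rewrite /regularization; case: pselect => // XT.
  by exfalso; have [p] := X1; apply; rewrite /X XT.
have [s' s's ss'] := injF_bij sI.
exists tt, s, id; split=> //.
- by move=> p; exists (s' p).
- by move=> p; exists p.
- apply: hom_comp hh; apply: pullback_hom; first by move=> p; exists (s' p).
  exact: sz_bij.
- by apply: hom_comp hh'; apply: pullback_hom => // p; exists p.
Qed.
End Finite.

Section Unsized.
Hypothesis noI : I -> False.
Let sz0 i T : ~ sz i (set0 : set T). Proof. by case: (noI i). Qed.

(** On a regularization, x or not x is the full set if the set is nonempty and proper, and 1
    otherwise. *)
Definition boundary_term : 'I_1 -> term L unit :=
  fun=> tjoin (Var L tt) (tneg (Var L tt)).

Lemma boundary_probed (T : Type) (X : set T) j :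
  (exists p, X p) -> (exists p, ~ X p) -> probed sz boundary_term (Some X) j.
Proof.
move=> [p Xp] [q Xq]; apply/fullP; split=> [r|].
  by rewrite force_eval_join force_neg_leaf /=; apply: EM.
by rewrite force_eval_join (force_neg_root _ p) /= => -[//|/(_ p)].
Qed.

Lemma probed_boundary (T : Type) (X : set T) j (t0 : T) :
  probed sz boundary_term (regularization X) j ->
  (exists p, X p) /\ (exists p, ~ X p).
Proof.
move/fullP => [_]; rewrite force_eval_join (force_neg_root _ t0).
move/not_orP => [H1 /existsNP[p H2]]; split.
  by exists p; move/contrapT: H2; rewrite /= force_regularization_leaf.
by apply/existsNP; move: H1; rewrite /= force_regularization_root.
Qed.

Variable M : class L.

Lemma omega_strong_Beth :
  (forall A, M A <-> models_eqs_of (pt_alg sz nat) A) -> strong_Beth M.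
Proof.
move=> ME; apply: strong_Beth_interpolant => k f A a b fP fab.
pose pts (i : {T : Type & T}) := projT1 i.
pose coord (i : {T : Type & T}) (h : A -> pt_alg sz (pts i)) := homomorphism h.
apply: (@interpolant _ sz _ _ _ _ _ pts coord _ boundary_term) => //.
- by move=> i; split; exact: projT2 i.
- move=> x y xy; apply: contrapT => nxy.
  have [T [h [[t0] hh hxy]]] :=
    omega_representation noI 0 ((ME _).1 (memberP A)) nxy.
  by apply: hxy; apply: (xy (existT _ T t0)).
- by move=> i h hh p i'; apply: hom_comp hh; apply: chi_hom.
- move=> [T t0] g h hg hh.
  have MD : M (pt_alg sz T) by apply/ME; apply: models_eqs_omega.
  exact: (beth_agree (C := Member MD) fP fab).
- by move=> i X X1 X2; exists ord0; apply: boundary_probed.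
move=> [T t0] h [T' t0'] h' hh hh' prf prf' H.
(* The cell of [p] is either everything, so that the second clause of [H] applies, or nonempty and
   proper, so that the probe detects it. *)
have fwd p : exists p', prf' p' = prf p.
  have [_ H1 H2] := H (prf p).
  have [F|/existsNP nF] := pselect (forall q, prf q = prf p).
    by exists t0'; apply: H1.
  suff /H2/(probed_boundary t0')[[q Hq] _] :
    probed sz boundary_term (regularization [set q | prf q = prf p]) ord0.
    by exists q.
  rewrite /regularization; case: pselect => /= [XT|_].
    by exfalso; have [q] := nF; have : [set: T] q by []; rewrite -XT.
  by apply: boundary_probed; first by exists p.
have bwd p' : exists p, prf p = prf' p'.
  have [H0 _ _] := H (prf' p'); apply: contrapT => /forallNP np.
  exact: (H0 np p').
pose T2 := {q : T * T' | prf q.1 = prf' q.2}.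
have fsurj p : exists q : T2, (sval q).1 = p.
  by have [p' pp'] := fwd p; exists (exist _ (p, p') (esym pp')).
have fsurj' p' : exists q : T2, (sval q).2 = p'.
  by have [p pp'] := bwd p'; exists (exist _ (p, p') pp').
have [q0 _] := fsurj t0.
exists (existT _ T2 q0), (fun q : T2 => (sval q).1),
  (fun q : T2 => (sval q).2).
split=> //; first by case.
- by apply: hom_comp hh; apply: pullback_hom => // i; case: (noI i).
- by apply: hom_comp hh'; apply: pullback_hom => // i; case: (noI i).
Qed.

(** Among at most two points a nonempty proper set is a singleton, so the boundary probe already
    determines cardinalities. *)
Lemma small_strong_Beth (n : nat) : n < 2 ->
  (forall A, M A <-> models_eqs_of (pt_alg sz 'I_n.+1) A) -> strong_Beth M.
Proof.
move=> n2 ME; apply: (@finite_strong_Beth sz0 n _ boundary_term) => //.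
- move=> X X0 X1; exists ord0; first exact: boundary_probed.
  have card1 (Y : set 'I_n.+1) : (exists p, Y p) -> (exists p, ~ Y p) ->
      set_card Y = 1.
    move=> [p Yp] [q Yq]; apply/eqP; rewrite eqn_leq; apply/andP; split.
      rewrite -ltnS (leq_trans _ (_ : n.+1 <= 2)) // -[X in _ < X]card_ord.
      rewrite -cardsT; apply: proper_card; rewrite properT; apply/eqP => YT.
      have := finset.in_setT q; rewrite -YT inE.
      by move/asboolP.
    by apply/card_gt0P; exists p; rewrite inE; apply/asboolP.
  move=> X' /(probed_boundary ord0)[X0' X1'].
  by rewrite !card1.
- by move=> A /ME.
- exact/ME/models_eqs_refl.
Qed.

(* [powerset_top 'I_0] has no leaf; its two elements are found again as the
   elements 0 and 1 of [powerset_top unit]. *)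
Lemma boolean_strong_Beth :
  (forall A, M A <-> models_eqs_of (pt_alg sz 'I_0) A) -> strong_Beth M.
Proof.
move=> ME; apply: strong_Beth_interpolant => k f A a b fP fab.
pose coord (_ : unit) (h : A -> pt_alg sz unit) :=
  homomorphism h /\ forall x, force (Some tt) (h x) -> force None (h x).
pose lift (x : pt_alg sz 'I_0) : pt_alg sz unit :=
  if x is Some _ then Some set0 else None.
have lift_force w x : force w (lift x) = force None x by case: x w => [X|] [].
have rootE (w : option 'I_0) x : force w x <-> force None x by case: w => // -[].
have lift_hom : homomorphism lift.
  apply: pt_homP => // [x y|x y|x y].
  - by apply: force_ext => w; rewrite lift_force !force_meet !lift_force.
  - by apply: force_ext => w; rewrite lift_force !force_join !lift_force.
  - have impE : (forall w, force w x -> force w y) <->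
        (force None x -> force None y).
      by split=> [/(_ None)//|H w]; rewrite !rootE.
    apply: force_ext => -[p|]; rewrite lift_force !forceE impE ?lift_force //.
    by split=> [H w|/(_ None)]; rewrite !lift_force.
apply: (@interpolant _ sz _ _ _ _ unit _ coord _ boundary_term) => //.
- by move=> i h [].
- move=> x y xy; apply: contrapT.
  case/(finite_representation sz0 ((ME _).1 (memberP A))) => h hh hxy.
  apply: hxy; have : lift (h x) = lift (h y).
    apply: (xy tt (lift \o h)); split; first exact: hom_comp.
    by move=> z; rewrite /= !lift_force.
  move=> E; apply: force_ext => w.
  by rewrite !rootE -!(lift_force None) E.
- move=> _ h [hh _] p []; split; first by apply: hom_comp hh; apply: chi_hom.
  by move=> x; rewrite /= !force_chi.
- move=> [] g h [hg g2] [hh h2] gh.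
  (* The collapse at [tt] lands in the two-element algebra, a member of [M], and loses nothing on
     maps with values in {0, 1}. *)
  have MD : M (pt_alg sz 'I_0) by apply/ME; apply: models_eqs_refl.
  have := beth_agree (C := Member MD) fP fab
    (hom_comp (@chi_hom _ _ sz0 _ _ tt) hg)
    (hom_comp (@chi_hom _ _ sz0 _ _ tt) hh) _.
  move=> /(_ (fun l => congr1 _ (gh l)))/(congr1 (force None)).
  rewrite /= !force_chi => E; apply: force_ext => -[[]|]; first by rewrite E.
  split=> H; [apply: h2; rewrite -E|apply: g2; rewrite E]; exact: force_root.
- by move=> [] X [[] Xt] [[] nXt].
move=> [] h [] h' [hh h2] [hh' h2'] prf prf' H.
have idE : @pullback unit unit id = id.
  by apply: funext => x; apply: force_ext => w; rewrite force_pullback; case: w.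
exists tt, id, id; split=> //; try by move=> p; exists p.
- by case; have [_ H1 _] := H (prf tt); rewrite H1 // => -[].
- by rewrite idE.
- by rewrite idE.
Qed.
End Unsized.
End StrongBeth.

(** * Primitive positive formulas *)

Section PrimitivePositive.
Variable L : language.

Lemma extend_comp (A B V : Type) (h : A -> B) (e : V -> A) b :
  h \o extend e b = extend (h \o e) (h b).
Proof. by apply: funext => -[]. Qed.

Lemma pp_formula_hom (A B : algebra L) (h : A -> B) (V : Type) (e : V -> A)
    (p : formula L V) :
  homomorphism h -> pp_formula p -> sat e p -> sat (h \o e) p.
Proof.
move=> hh; have eqs W (e' : W -> A) (q : formula L W) :
    equation_conjunction q -> sat e' q -> sat (h \o e') q.
  elim: q e' => // [W' t u|W' q IHq r IHr] e' /=.
    by move=> _ /(congr1 h); rewrite !(hom_eval _ _ hh).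
  by move=> /andP[/IHq Hq /IHr Hr] [/Hq ? /Hr].
elim: p e => // [V' t u|V' p _ q _|V' p IH] e Hp.
- exact: eqs.
- exact: eqs.
- by case=> b Hb; exists (h b); rewrite -extend_comp; apply: IH.
Qed.

Lemma pp_formula_power (D : algebra L) (J V : Type) (e : V -> power D J)
    (p : formula L V) :
  pp_formula p -> (forall j, sat (fun v => e v j) p) -> sat e p.
Proof.
have eqs W (e' : W -> power D J) (q : formula L W) : equation_conjunction q ->
    (forall j, sat (fun v => e' v j) q) -> sat e' q.
  elim: q e' => // [W' t u|W' q IHq r IHr] e' /=.
    by move=> _ H; apply: funext => j; rewrite !eval_power.
  move=> /andP[/IHq Hq /IHr Hr] H.
  by split; [apply: Hq => j; have [] := H j|apply: Hr => j; have [] := H j].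
elim: p e => // [V' t u|V' p _ q _|V' p IH] e Hp.
- exact: eqs.
- exact: eqs.
- move=> /choice[b Hb]; exists b; apply: IH => // j.
  have -> : (fun v => extend e b v j) = extend (fun v => e v j) (b j).
    by apply: funext => -[].
  exact: Hb.
Qed.

Definition satisfies_all (A : algebra L) (V : Type) (e : V -> A)
    (s : seq (term L V * term L V)) :=
  foldr (fun tu P => eval e tu.1 = eval e tu.2 /\ P) True s.

Lemma satisfies_all_cat (A : algebra L) (V : Type) (e : V -> A) s1 s2 :
  satisfies_all e (s1 ++ s2) <-> satisfies_all e s1 /\ satisfies_all e s2.
Proof. by elim: s1 => /= [|x s1 ->]; tauto. Qed.

Lemma satisfies_all_map (A : algebra L) (V : Type) (e : V -> A) (J : eqType)
    (F : J -> term L V * term L V) (r : seq J) :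
  satisfies_all e (map F r) <->
  forall j, j \in r -> eval e (F j).1 = eval e (F j).2.
Proof.
elim: r => //= j r ->; split=> [[Hj Hr] j'|H].
  by rewrite inE => /orP[/eqP->|/Hr].
by split=> [|j' j'r]; apply: H; rewrite inE ?eqxx ?j'r ?orbT.
Qed.

Definition conjunction (V : Type) (s : seq (term L V * term L V)) :=
  foldr (fun tu p => Fand (Feq tu.1 tu.2) p) (Ftrue L V) s.

Definition absurd_index (V : Type) (v : V + 'I_0) : V :=
  match v with inl v => v | inr i => nullary V i end.

Definition shift_index (V : Type) (N : nat) (v : V + 'I_N.+1) : option V + 'I_N :=
  match v with
  | inl v => inl (Some v)
  | inr i => if unlift ord0 i is Some j then inr j else inl None
  end.

Definition map_eqs (V W : Type) (f : V -> W) (s : seq (term L V * term L V)) :=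
  [seq (tmap f tu.1, tmap f tu.2) | tu <- s].

Lemma satisfies_map_eqs (A : algebra L) (V W : Type) (f : V -> W) (e : W -> A) s :
  satisfies_all e (map_eqs f s) <-> satisfies_all (e \o f) s.
Proof. by elim: s => //= tu s ->; rewrite !eval_tmap. Qed.

(** The variables [inr] are quantified in turn: [shift_index] renames the first one to the newly
    bound [None]. *)
Fixpoint exists_eqs (N : nat) :
    forall V : Type, seq (term L (V + 'I_N) * term L (V + 'I_N)) -> formula L V :=
  match N with
  | 0 => fun V s => conjunction (map_eqs (@absurd_index V) s)
  | N'.+1 => fun V s => Fex (exists_eqs (map_eqs (@shift_index V N') s))
  end.

Definition sum_eval (A V : Type) (N : nat) (e : V -> A) (z : 'I_N -> A)
  (v : V + 'I_N) : A := match v with inl v => e v | inr i => z i end.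

Lemma sat_exists_eqs (A : algebra L) (N : nat) (V : Type) (e : V -> A)
    (s : seq (term L (V + 'I_N) * term L (V + 'I_N))) :
  sat e (exists_eqs s) <-> exists z : 'I_N -> A, satisfies_all (sum_eval e z) s.
Proof.
elim: N V e s => [|N IH] V e s /=.
  have -> : sat e (conjunction (map_eqs (@absurd_index V) s)) <->
      satisfies_all e (map_eqs (@absurd_index V) s).
    by elim: (map_eqs _ s) => //= tu r ->.
  rewrite satisfies_map_eqs.
  have E z : e \o @absurd_index V = sum_eval e z.
    by apply: funext => -[v|[]].
  by split=> [|[z]]; [exists (@nullary A)|]; rewrite -?E.
split=> [[b /IH[z]]|[z Hz]].
  pose z' i := if unlift ord0 i is Some j then z j else b.
  have E : sum_eval (extend e b) z \o @shift_index V N = sum_eval e z'.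
    by apply: funext => -[v|i] //=; rewrite /z'; case: unliftP.
  by rewrite satisfies_map_eqs E; exists z'.
exists (z ord0); apply/IH; exists (fun j => z (lift ord0 j)).
rewrite satisfies_map_eqs.
have -> // : sum_eval (extend e (z ord0)) (fun j => z (lift ord0 j)) \o
  @shift_index V N = sum_eval e z.
by apply: funext => -[v|i] //=; case: unliftP => [j|] ->.
Qed.

Lemma pp_exists_eqs (N : nat) (V : Type)
    (s : seq (term L (V + 'I_N) * term L (V + 'I_N))) :
  pp_formula (exists_eqs s).
Proof.
elim: N V s => [|N IH] V s //=.
have : equation_conjunction (conjunction (map_eqs (@absurd_index V) s)).
  by elim: s.
by case: (conjunction _).
Qed.

Variable K : class L.

Definition functional (n : nat) (p : formula L (option 'I_n)) :=
  forall A : algebra L, K A -> forall (a : 'I_n -> A) (b b' : A),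
    sat (extend a b) p -> sat (extend a b') p -> b = b'.

Definition pfun_of (n : nat) (p : formula L (option 'I_n)) : pfun K n :=
  fun A a => match pselect (exists b : A, sat (extend a b) p) with
             | left H => Some (projT1 (cid H))
             | right _ => None
             end.

Lemma pfun_ofP (n : nat) (p : formula L (option 'I_n)) :
  functional p -> defines p (pfun_of p).
Proof.
move=> fp A a b; rewrite /pfun_of; case: pselect => [H|nH]; last first.
  by split=> // Hb; case: nH; exists b.
case: (cid H) => b' Hb' /=; split=> [[<-]//|Hb].
by congr Some; apply: (fp A (memberP A) _ _ _ Hb').
Qed.

Lemma pp_pfun_implicit (n : nat) (p : formula L (option 'I_n)) :
  0 < n -> functional p -> pp_formula p -> implicit_operation (pfun_of p).
Proof.
move=> n0 fp pp; split=> //; first by exists p; apply: pfun_ofP.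
move=> A B h hh a b /(pfun_ofP fp) /(pp_formula_hom hh pp) Hb.
by apply/(pfun_ofP fp); rewrite -extend_comp.
Qed.

End PrimitivePositive.

Arguments pfun_of {L K n} p A a.

(** * Translation between Heyting terms and terms of an expansion *)

Section Translation.
Variables (I : Type) (ar : I -> nat).

Fixpoint to_expansion (V : Type) (t : term heyting V) :
    term (expand heyting ar) V :=
  match t with
  | Var v => Var _ v
  | App s args => @App (expand heyting ar) V (inl s) (fun i => to_expansion (args i))
  end.

Lemma eval_to_expansion (A : algebra (expand heyting ar)) (V : Type) (e : V -> A) t :
  eval e (to_expansion t) = eval (A := reduct A) e t.
Proof.
elim: t => //= s args IH; congr (op A (inl s)).
by apply: funext => i; apply: IH.
Qed.

Lemma models_eqs_reduct (D A : algebra (expand heyting ar)) :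
  models_eqs_of D A -> models_eqs_of (reduct D) (reduct A).
Proof.
move=> DA t u tu e; rewrite -!(@eval_to_expansion A); apply: DA => e'.
by rewrite !eval_to_expansion.
Qed.

Hypothesis noI : I -> False.

Fixpoint to_reduct (V : Type) (t : term (expand heyting ar) V) : term heyting V :=
  match t with
  | Var v => Var _ v
  | App s args =>
      match s return ('I_(@arity (expand heyting ar) s) -> term heyting V) -> _ with
      | inl s => fun args => @App heyting V s args
      | inr i => fun _ => match noI i with end
      end (fun i => to_reduct (args i))
  end.

Lemma eval_to_reduct (A : algebra (expand heyting ar)) (V : Type) (e : V -> A) t :
  eval (A := reduct A) e (to_reduct t) = eval e t.
Proof.
elim: t => //= -[s|i] args IH; last by case: (noI i).
by rewrite /=; congr (op A (inl s)); apply: funext => i; apply: IH.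
Qed.

Lemma models_eqs_expansion (D A : algebra (expand heyting ar)) :
  models_eqs_of (reduct D) (reduct A) -> models_eqs_of D A.
Proof.
move=> DA t u tu e; rewrite -!(@eval_to_reduct A); apply: DA => e'.
by rewrite !(@eval_to_reduct D).
Qed.

Definition expand_void (B : algebra heyting) : algebra (expand heyting ar) :=
  @Algebra (expand heyting ar) B (fun s =>
    match s return ('I_(@arity (expand heyting ar) s) -> B) -> B with
    | inl s => @op _ B s
    | inr i => match noI i with end
    end).

Lemma reduct_expand_void (B : algebra heyting) : reduct (expand_void B) = B.
Proof. by case: B. Qed.
End Translation.

(** * A formula counting the points of a subset *)

Lemma card_prefix (n : nat) (j : 'I_n) : #|[set l : 'I_n | l <= j]%SET| = j.+1.
Proof.
have -> : [set l : 'I_n | l <= j]%SET = widen_ord (ltn_ord j) @: 'I_j.+1.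
  apply/setP => l; rewrite inE; apply/idP/imsetP => [lj|[l' _ ->]].
    by exists (Ordinal (lj : l < j.+1)) => //; apply: val_inj.
  by rewrite -ltnS /=.
rewrite card_imset ?card_ord // => l l' /(congr1 val) /= ll'.
exact: val_inj.
Qed.

Definition no_size (i : void) (T : Type) (X : set T) : Prop :=
  match i with end.

(* The only homomorphisms from [powerset_top 'I_n.+1] to itself which do not take
   their values in {0, 1} come from permutations.  So equations can say that
   either x is in {0, 1}, or the variables z_l are the singletons and x is the
   union of the z_l with l <= j, where j is the only index at which the element
   u_j is the full set, all the other u_l being 1. *)
Section SizeFormula.
Variables (n : nat) (m : 'I_n.+1).
Local Notation L := (expand heyting (fun _ : void => 1)).
Local Notation var := (option 'I_1 + 'I_(n.+1 + n.+1))%type.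
Local Notation D := (pt_alg no_size 'I_n.+1).
Local Notation x := (Var L (inl (Some ord0) : var)).
Local Notation y := (Var L (inl None : var)).
Local Notation z l := (Var L (inr (lshift n.+1 l) : var)).
Local Notation u l := (Var L (inr (rshift n.+1 l) : var)).
Local Notation top := (ttop (fun _ : void => 1) var).

Definition union_term : term L var := tjoins [seq z l | l <- enum 'I_n.+1].
Definition prefix_term (j : 'I_n.+1) : term L var :=
  tjoins [seq z l | l <- enum [pred l : 'I_n.+1 | l <= j]].
Local Notation s := union_term.
Local Notation prefix := prefix_term.

(** The union [s] of the z_l contains every leaf, so it is the full set T or 1. If it is 1, all u_l
    are 1 and x is 0 or 1. If it is T, no z_l is empty, so they are the n + 1 singletons; exactly
    one u_j is not 1, and x is the union of z_0, ..., z_j. *)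
Definition size_equations : seq (term L var * term L var) :=
  [seq (tneg (tmeet (z l.1) (z l.2)), top) |
     l <- enum [pred l : 'I_n.+1 * 'I_n.+1 | l.1 != l.2]] ++
  [seq (timp (tneg (z l)) s, top) | l <- enum 'I_n.+1] ++
  [seq (tjoin (u l.1) (u l.2), top) |
     l <- enum [pred l : 'I_n.+1 * 'I_n.+1 | l.1 != l.2]] ++
  [seq (tjoin (u l) (tiff x (prefix l)), top) | l <- enum 'I_n.+1] ++
  [:: (tmeets [seq u l | l <- enum 'I_n.+1], s); (tneg (tneg s), top);
      (timp s (tjoin x (tneg x)), top); (y, u m)].

Section Semantics.
Variable e : var -> D.
Local Notation xv := (e (inl (Some ord0)) : pt_carrier 'I_n.+1).
Local Notation yv := (e (inl None) : pt_carrier 'I_n.+1).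
Local Notation zv l := (e (inr (lshift n.+1 l)) : pt_carrier 'I_n.+1).
Local Notation uv l := (e (inr (rshift n.+1 l)) : pt_carrier 'I_n.+1).

Record size_configuration : Prop := SizeConfiguration {
  size_disjoint : forall l l' p, l != l' ->
    force (Some p) (zv l) -> force (Some p) (zv l') -> False;
  size_nonempty : forall l, (forall p, ~ force (Some p) (zv l)) ->
    exists l', force None (zv l');
  size_selector : forall l l', l != l' ->
    force None (uv l) \/ force None (uv l');
  size_prefix : forall j, force None (uv j) \/
    forall w, force w xv <-> exists2 l : 'I_n.+1, l <= j & force w (zv l);
  size_meet : forall w, (forall l, force w (uv l)) <-> exists l, force w (zv l);
  size_cover : forall p, exists l, force (Some p) (zv l);
  size_two : forall l, force None (zv l) ->
    force None xv \/ forall p, ~ force (Some p) xv;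
  size_value : yv = uv m }.

Lemma force_s w : force w (eval e s) <-> exists l, force w (zv l).
Proof.
rewrite force_tjoins; split=> [[l _ Hl]|[l Hl]]; exists l => //.
by rewrite mem_enum.
Qed.

Lemma eq_top (t : term L var) : eval e t = eval e top <-> force None (eval e t).
Proof.
split=> [->|]; first by rewrite force_eval_top.
move=> H; apply: force_ext => w; rewrite force_eval_top; split=> // _.
exact: force_root.
Qed.

Lemma satisfies_size_equations :
  satisfies_all e size_equations <-> size_configuration.
Proof.
have disj (l l' : 'I_n.+1) : eval e (tneg (tmeet (z l) (z l'))) = eval e top <->
    forall p, force (Some p) (zv l) -> force (Some p) (zv l') -> False.
  rewrite eq_top (force_neg_root _ ord0).
  by split=> H p; have := H p; rewrite force_eval_meet /=; tauto.
(* Once the z_l cover the leaves, the implication holds at every leaf and only the root carries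
   information. *)
have nonempty l : (forall p, exists l, force (Some p) (zv l)) ->
    eval e (timp (tneg (z l)) s) = eval e top <->
    ((forall p, ~ force (Some p) (zv l)) -> exists l', force None (zv l')).
  move=> cov; rewrite eq_top force_eval_imp_root.
  split=> [/(_ None)|H [p|]].
  - by rewrite (force_neg_root _ ord0) force_s.
  - by rewrite force_s => _; apply: cov.
  - by rewrite (force_neg_root _ ord0) force_s.
have prefixE j : eval e (tjoin (u j) (tiff x (prefix j))) = eval e top <->
    force None (uv j) \/
    forall w, force w xv <-> exists2 l : 'I_n.+1, l <= j & force w (zv l).
  rewrite eq_top force_eval_join force_tiff.
  have prefE w : force w (eval e (prefix j)) <->
      exists2 l : 'I_n.+1, l <= j & force w (zv l).
    rewrite force_tjoins.
    by split=> -[l lj Hl]; exists l => //; move: lj; rewrite mem_enum.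
  split=> -[]; [by left| |by left|]; right.
    by move=> w; rewrite -prefE; have -> : xv = eval e (prefix j).
  by apply: force_ext => w; rewrite prefE.
have meetE : eval e (tmeets [seq u l | l <- enum 'I_n.+1]) = eval e s <->
    forall w, (forall l, force w (uv l)) <-> exists l, force w (zv l).
  have mE w : force w (eval e (tmeets [seq u l | l <- enum 'I_n.+1])) <->
      forall l, force w (uv l).
    rewrite force_tmeets.
    by split=> H l; [apply: H; rewrite mem_enum|move=> _; apply: H].
  split=> [E w|H]; first by rewrite -mE E force_s.
  by apply: force_ext => w; rewrite mE H force_s.
have covE : eval e (tneg (tneg s)) = eval e top <->
    forall p, exists l, force (Some p) (zv l).
  by rewrite eq_top (force_negneg_root _ ord0); split=> H p; apply/force_s.
have twoE : eval e (timp s (tjoin x (tneg x))) = eval e top <->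
    forall l, force None (zv l) ->
    force None xv \/ forall p, ~ force (Some p) xv.
  rewrite eq_top force_eval_imp_root; split=> [/(_ None) H l Hl|H [p|]].
  - have : force None (eval e s) by apply/force_s; exists l.
    by move/H; rewrite force_eval_join (force_neg_root _ ord0).
  - by rewrite force_eval_join force_neg_leaf => _; apply: EM.
  - by rewrite force_s force_eval_join (force_neg_root _ ord0) => -[l /H].
rewrite /size_equations !satisfies_all_cat !satisfies_all_map.
split=> [[H1 [H2 [H3 [H4 [H5 [H6 [H7 [H8 _]]]]]]]]|[H1 H2 H3 H4 H5 H6 H7 H8]].
  have H6' := covE.1 H6; split=> //.
  - move=> l l' p ll'; apply: (disj l l').1.
    by have := H1 (l, l'); rewrite mem_enum => /(_ ll').
  - by move=> l; apply/(nonempty l H6'); apply: H2; rewrite mem_enum.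
  - move=> l l' ll'; have := H3 (l, l'); rewrite mem_enum => /(_ ll').
    by rewrite eq_top force_eval_join.
  - by move=> j; apply/prefixE; apply: H4; rewrite mem_enum.
  - exact/meetE.
  - exact/twoE.
split; first by case=> l l'; rewrite mem_enum => ll'; apply/disj => p;
  apply: (H1 l l' p ll').
split; first by move=> l _; apply/(nonempty l H6); apply: H2.
split.
  case=> l l'; rewrite mem_enum => ll'; apply/eq_top.
  by rewrite force_eval_join; apply: (H3 l l' ll').
split; first by move=> j _; apply/prefixE; apply: H4.
split; first exact/meetE.
by split; [apply/covE|split; [apply/twoE|split]].
Qed.

Lemma size_configuration_value : size_configuration ->
  yv = if xv is Some X then if set_card X == m.+1 then Some setT else None
       else None.
Proof.
case=> disj nonempty sel pre meet cov two ->.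
have [sN|sN] := pselect (exists l, force None (zv l)).
  have -> : uv m = None by rewrite -force_rootE; apply: ((meet None).2 sN).
  have [l /two] := sN; case: (xv) => // X [//|X0].
  rewrite /set_card (_ : [set p | _]%SET = finset.set0) ?cards0 //.
  by apply/setP => p; rewrite !inE; apply/asboolP; apply: X0.
(* No z_l is 1, hence none is empty. By disjointness a choice of points is injective, hence
   bijective, and each z_l is a singleton. *)
have /choice[g Hg] : forall l, exists p, force (Some p) (zv l).
  by move=> l; apply: contrapT => /forallNP/nonempty.
have g_inj : injective g.
  move=> l l' gl; apply/eqP; apply: contrapT => /negP ll'.
  by apply: (disj l l' (g l)) => //; rewrite gl.
have [g' gg' g'g] := injF_bij g_inj.
have zE l p : force (Some p) (zv l) <-> p = g l.
  split=> [Hp|->//]; rewrite -(g'g p); congr g; apply/eqP.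
  apply: contrapT => /negP ll'; apply: (disj _ _ p ll' _ Hp).
  by rewrite -{1}(g'g p).
have [j uj] : exists j, ~ force None (uv j).
  by apply/existsNP => H; apply: sN; apply/(meet None).
have [//|xE] := pre j.
have xN : ~ force None xv by move/xE => [l _ Hl]; apply: sN; exists l.
have xcard X : xv = Some X -> set_card X = j.+1.
  move=> xX; have -> : j.+1 = #|[set g l | l in [set l : 'I_n.+1 | l <= j]]%SET|.
    by rewrite card_imset // card_prefix.
  apply: eq_card => p; rewrite inE; apply/asboolP/imsetP.
    move=> Xp; have /xE[l lj /zE ->] : force (Some p) xv by rewrite xX.
    by exists l; rewrite ?inE.
  move=> [l + ->]; rewrite inE => lj.
  have : force (Some (g l)) xv by apply/xE; exists l.
  by rewrite xX.
have uE l : uv l = if l == j then Some setT else None.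
  case: eqP => [->|/eqP lj].
    apply/fullP; split=> // p; have [l' Hl'] := cov p.
    by apply: ((meet (Some p)).2 _); exists l'.
  by rewrite -force_rootE; have [|] := sel _ _ lj.
move: xN xcard; rewrite uE; case: (xv) => [X _ /(_ X erefl) ->|[]//].
by rewrite eqSS eq_sym.
Qed.
End Semantics.

(** For x in {0, 1}, take z_0 = 1, the other z_l empty and all u_l = 1. Otherwise number the points
    so that those of x come first. *)
Lemma size_configuration_exists (xv : pt_carrier 'I_n.+1) :
  exists w : 'I_(n.+1 + n.+1) -> D, forall yv : pt_carrier 'I_n.+1,
    yv = (if xv is Some X then if set_card X == m.+1 then Some setT else None
          else None) ->
    size_configuration (sum_eval (extend (fun=> xv : D) (yv : D)) w).
Proof.
pose W (Z U : 'I_n.+1 -> pt_carrier 'I_n.+1) (i : 'I_(n.+1 + n.+1)) :=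
  match split i with inl l => Z l | inr l => U l end.
have WZ Z U l : W Z U (lshift n.+1 l) = Z l.
  by rewrite /W (unsplitK (inl l)).
have WU Z U l : W Z U (rshift n.+1 l) = U l.
  by rewrite /W (unsplitK (inr l)).
have [two|ntwo] := pselect (force None xv \/ forall p, ~ force (Some p) xv).
  pose Z (l : 'I_n.+1) : pt_carrier 'I_n.+1 := if l == ord0 then None else Some set0.
  have ZE l w : force w (Z l) <-> l == ord0.
    by rewrite /Z; case: eqP => // _; rewrite force_bot.
  exists (W Z (fun=> None)) => yv yvE.
  split=> [l l' p|l|l l'|j|w|p|l|] /=; rewrite ?WZ ?WU //.
  - by rewrite !ZE => /[swap] /eqP -> /[swap] /eqP ->; rewrite eqxx.
  - by exists ord0; rewrite WZ ZE.
  - by left.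
  - by left.
  - by split=> // _ ; [exists ord0; rewrite WZ ZE|move=> l; rewrite WU].
  - by exists ord0; rewrite WZ ZE.
  - rewrite yvE; case: xv two yvE => // X [//|X0] _.
    rewrite /set_card (_ : [set p | _]%SET = finset.set0) ?cards0 //.
    by apply/setP => p; rewrite !inE; apply/asboolP; apply: X0.
case: xv ntwo => [X|] ntwo; last by exfalso; apply: ntwo; left.
have [p0 Xp0] : exists p, X p.
  by apply: contrapT => /forallNP nX; apply: ntwo; right.
(* The index [j] stands for the size j + 1. *)
have [j jE] : exists j : 'I_n.+1, set_card X = j.+1.
  have X_gt0 : 0 < set_card X by apply/card_gt0P; exists p0; rewrite inE; apply/asboolP.
  have X_le : (set_card X).-1 < n.+1.
    by rewrite prednK // -[X in _ <= X]card_ord max_card.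
  by exists (Ordinal X_le); rewrite /= prednK.
(* Comparing the indicators of [X] and of the first j + 1 indices gives a permutation taking these
   indices onto [X]. *)
have [c|g g_inj gE] := @same_fibers _ _ (fun p => `[< X p >]) (fun l : 'I_n.+1 => l <= j).
  have countE (u : 'I_n.+1 -> bool) : set_card [set p | u p = c] =
      if c then #|[set p | u p]%SET| else n.+1 - #|[set p | u p]%SET|.
    case: c; first by apply: eq_card => p; rewrite !inE; apply/asboolP/idP.
    rewrite -[X in _ = X - _]card_ord -(cardsC [set p | u p]%SET) addKn.
    by apply: eq_card => p; rewrite !inE; apply/asboolP/idP => [->|/negbTE].
  by rewrite !countE card_prefix -jE.
have [g' gg' g'g] := injF_bij g_inj.
have XE p : X p <-> exists2 l : 'I_n.+1, l <= j & p = g l.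
  split=> [Xp|[l lj ->]]; last by apply/asboolP; rewrite gE.
  by exists (g' p); rewrite ?g'g // -gE g'g; apply/asboolP.
pose Z l : pt_carrier 'I_n.+1 := Some [set g l].
pose U l : pt_carrier 'I_n.+1 := if l == j then Some setT else None.
exists (W Z U) => yv yvE.
split=> [l l' p|l|l l'|j'|w|p|l|] /=; rewrite ?WZ ?WU //=.
- by move=> /eqP ll' -> /g_inj.
- by move/(_ (g l)).
- move=> ll'; rewrite /U; case: (eqVneq l j) ll' => [->|]; last by left.
  by rewrite eq_sym => /negbTE ->; right.
- rewrite /U; case: eqP => [->|]; last by left.
  right=> -[p|]; last by split=> // -[l _]; rewrite WZ.
  split=> [/XE[l lj pl]|[l lj]]; first by exists l; rewrite ?WZ.
  by rewrite WZ => pl; apply/XE; exists l.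
- case: w => [p|]; last first.
    by split=> [/(_ j)|[l]]; rewrite ?WZ ?WU // /U eqxx.
  split=> [_|_ l]; first by exists (g' p); rewrite WZ /= g'g.
  by rewrite WU /U; case: eqP.
- by exists (g' p); rewrite WZ /= g'g.
- by rewrite yvE jE eqSS /U eq_sym.
Qed.

Lemma size_equationsP (xv yv : pt_carrier 'I_n.+1) :
  (exists w : 'I_(n.+1 + n.+1) -> D,
    satisfies_all (sum_eval (extend (fun=> xv : D) (yv : D)) w) size_equations)
  <-> yv = (if xv is Some X then if set_card X == m.+1 then Some setT else None
            else None).
Proof.
split=> [[w /satisfies_size_equations /size_configuration_value]//|yvE].
have [w Hw] := size_configuration_exists xv.
by exists w; apply/satisfies_size_equations; apply: Hw.
Qed.
End SizeFormula.

(** * Quotients *)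

Section Quotients.
Variables (L : language) (A : algebra L) (r : A -> A -> Prop).
Hypothesis cong : congruence r.

Lemma quotient_class_eq x y : r x y -> quotient_class r x = quotient_class r y.
Proof.
case: cong => -[rr rs rt] _ xy; apply: eq_exist.
apply: funext => w; apply: propext; split; first exact: rt (rs _ _ xy).
exact: rt xy.
Qed.

Lemma quotient_reprP x : r x (quotient_repr (quotient_class r x)).
Proof.
rewrite /quotient_repr; case: (cid _) => y /= ->.
by case: cong => -[rr _ _] _; apply: rr.
Qed.

Lemma quotient_class_hom : homomorphism (quotient_class r : A -> quotient r).
Proof.
move=> s a; apply: quotient_class_eq; apply: cong.2 => i.
exact: quotient_reprP.
Qed.

Lemma quotient_class_surj (C : quotient r) : exists x, quotient_class r x = C.
Proof.
by case: C => C [x Cx]; exists x; apply: eq_exist; rewrite Cx.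
Qed.
End Quotients.

Definition evaluation (L : language) (A D : algebra L) (x : A) :
  power D {h : A -> D | homomorphism h} := fun h => sval h x.

Lemma embedding_evaluation (L : language) (A D : algebra L) :
  (forall x y : A, x <> y -> exists2 h : A -> D, homomorphism h & h x <> h y) ->
  embedding (@evaluation L A D).
Proof.
move=> sep; split=> [s a|x y xy].
  by apply: funext => -[h hh]; apply: hh.
apply: contrapT => /sep[h hh]; apply.
exact: (congr1 (fun f => f (exist _ h hh)) xy).
Qed.

(** * The companion without new operations *)

Section Unexpanded.
Variable T : Type.
Local Notation K := (generated_variety (powerset_top T)).
Local Notation L := (expand heyting (fun _ : void => 1)).

Let noI : void -> False := fun i => match i with end.

Lemma reduct_varietyE (A : algebra L) :
  K (reduct A) <-> models_eqs_of (pt_alg no_size T) A.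
Proof.
rewrite generated_varietyE; split; last exact: models_eqs_reduct.
exact: (models_eqs_expansion noI (D := pt_alg no_size T)).
Qed.

Definition reduct_class : class L := fun A => K (reduct A).

Definition no_family (i : void) : pfun K 1 := match i with end.

Lemma expansions_no_family : expansions no_family = reduct_class.
Proof.
apply: funext => A; apply: propext; split=> [[]//|KA].
by exists KA; case.
Qed.

Lemma subalgebras_no_family : subalgebras (expansions no_family) = reduct_class.
Proof.
rewrite expansions_no_family; apply: funext => A; apply: propext.
split=> [[B [h [/reduct_varietyE MB hB]]]|MA]; last first.
  by exists A, id; split=> //; split.
by apply/reduct_varietyE; apply: models_eqs_embedding hB MB.
Qed.

Lemma reduct_class_simple : strong_Beth reduct_class ->
  simple_Beth_companion K reduct_class.
Proof.
move=> SB; have F0 : pp_family no_family by split; case.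
split; first by split=> //; exists no_family; rewrite subalgebras_no_family.
split; first by exists no_family; rewrite subalgebras_no_family.
by exists no_family; rewrite expansions_no_family.
Qed.

Lemma reduct_class_congruence_preserving : congruence_preserving K reduct_class.
Proof.
move=> A _ r; split=> -[[rE rop] Kr]; split=> //; split=> //.
  by move=> s; apply: (rop (inl s)).
by case=> // s; apply: rop.
Qed.
End Unexpanded.

(** * The companion with the operations counting points *)

(** An injective enumeration makes sense on every type. The index [i] stands for size i + 1, which
    excludes the empty set. *)
Definition has_size (n : nat) (i : 'I_n) (T : Type) (X : set T) : Prop :=
  exists2 g : 'I_i.+1 -> T, injective g & forall p, X p <-> exists l, g l = p.

Lemma has_size_set0 (n : nat) (i : 'I_n) (T : Type) : ~ has_size i (set0 : set T).
Proof. by case=> g _ /(_ (g ord0))[_]; apply; exists ord0. Qed.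

Lemma has_sizeE (n : nat) (i : 'I_n) (T : finType) (X : set T) :
  has_size i X <-> set_card X = i.+1.
Proof.
split=> [[g gI Xg]|XE].
  rewrite -[RHS]card_ord -(card_imset _ gI); apply: eq_card => p; rewrite inE.
  by apply/asboolP/imsetP => [/Xg[l <-]|[l _ ->]]; [exists l|apply/Xg; exists l].
rewrite /set_card in XE; pose S := [set p | `[< X p >]]%SET.
have ltS (l : 'I_i.+1) : l < #|S| by rewrite XE.
exists (fun l => enum_val (Ordinal (ltS l))).
  by move=> l l' /enum_val_inj /(congr1 val) /= /val_inj.
move=> p; split=> [Xp|[l <-]]; last first.
  by have := enum_valP (Ordinal (ltS l)); rewrite inE => /asboolP.
have pS : p \in S by rewrite inE; apply/asboolP.
have lt : enum_rank_in pS p < i.+1 by rewrite -XE.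
exists (Ordinal lt); rewrite -[RHS](enum_rankK_in pS pS).
by congr enum_val; apply: val_inj.
Qed.

Section HeytingSizeFormula.
Variables (n : nat) (m : 'I_n.+1).
Let noI : void -> False := fun i => match i with end.
Let noar (_ : void) := 1.
Local Notation L0 := (expand heyting noar).

Lemma satisfies_to_reduct (A : algebra L0) (V : Type) (e : V -> A) s :
  satisfies_all (A := reduct A) e
    [seq (to_reduct noI tu.1, to_reduct noI tu.2) | tu <- s] <->
  satisfies_all (A := A) e s.
Proof. by elim: s => //= tu s ->; rewrite !(@eval_to_reduct _ _ noI A). Qed.

Lemma satisfies_to_expansion (I : Type) (ar : I -> nat)
    (A : algebra (expand heyting ar)) (V : Type) (e : V -> A) s :
  satisfies_all (A := A) e
    [seq (to_expansion ar tu.1, to_expansion ar tu.2) | tu <- s] <->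
  satisfies_all (A := reduct A) e s.
Proof. by elim: s => //= tu s ->; rewrite !(@eval_to_expansion _ _ A). Qed.

Definition heyting_size_equations :=
  [seq (to_reduct noI tu.1, to_reduct noI tu.2) | tu <- size_equations m].

Definition size_formula : formula heyting (option 'I_1) :=
  exists_eqs heyting_size_equations.

Definition expanded_size_formula (I : Type) (ar : I -> nat) :
    formula (expand heyting ar) (option 'I_1) :=
  exists_eqs [seq (to_expansion ar tu.1, to_expansion ar tu.2) |
              tu <- heyting_size_equations].

Lemma sat_expanded_size_formula (I : Type) (ar : I -> nat)
    (A : algebra (expand heyting ar)) (e : option 'I_1 -> A) :
  sat e (expanded_size_formula ar) <-> sat (A := reduct A) e size_formula.
Proof.
rewrite /expanded_size_formula /size_formula !sat_exists_eqs.
by split=> -[w Hw]; exists w; move: Hw => /satisfies_to_expansion.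
Qed.

Definition exact_size (x : pt_carrier 'I_n.+1) : pt_carrier 'I_n.+1 :=
  if x is Some X then if set_card X == m.+1 then Some setT else None else None.

Lemma sat_size_formula (a : 'I_1 -> powerset_top 'I_n.+1) b :
  sat (extend a b) size_formula <-> b = exact_size (a ord0).
Proof.
rewrite (ord1_eta a) /size_formula sat_exists_eqs -size_equationsP.
by split=> -[w Hw]; exists w; move: Hw;
  move/(@satisfies_to_reduct (pt_alg no_size 'I_n.+1)).
Qed.

Local Notation K := (generated_variety (powerset_top 'I_n.+1)).

Lemma variety_separated (k : nat) (B : algebra heyting) (x y : B) :
  generated_variety (powerset_top 'I_k) B -> x <> y ->
  exists2 h : B -> powerset_top 'I_k, homomorphism h & h x <> h y.
Proof.
move=> KB xy; have sz0 (i : void) T : ~ no_size i (set0 : set T) by case: i.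
have DB : models_eqs_of (pt_alg no_size 'I_k) (expand_void noar noI B).
  by apply/reduct_varietyE; rewrite reduct_expand_void.
have [h hh hxy] := finite_representation sz0 DB xy.
by exists h => // s; apply: (hh (inl s)).
Qed.

(** Homomorphisms to the powerset algebra preserve the formula, whose only value there is
    [exact_size], and they separate points. *)
Lemma functional_size_formula : functional K size_formula.
Proof.
move=> A KA a b b' Hb Hb'; apply: contrapT => /(variety_separated KA)[h hh].
apply; have pp := pp_exists_eqs heyting_size_equations.
have := pp_formula_hom hh pp Hb; have := pp_formula_hom hh pp Hb'.
by rewrite !extend_comp !sat_size_formula => -> ->.
Qed.

Lemma size_pfunP (A : member K) a b :
  pfun_of size_formula A a = Some b <-> sat (extend a b) size_formula.
Proof. exact: pfun_ofP functional_size_formula _ _ _. Qed.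

Lemma sat_size_formula_power (J : Type)
    (a : 'I_1 -> power (powerset_top 'I_n.+1) J) :
  sat (extend a (fun j => exact_size (a ord0 j))) size_formula.
Proof.
apply: pp_formula_power => [|j]; first exact: pp_exists_eqs.
have -> : (fun v => extend a (fun j => exact_size (a ord0 j)) v j) =
    extend (fun i => a i j) (exact_size (a ord0 j)).
  by apply: funext => -[].
exact/sat_size_formula.
Qed.

Lemma size_pfun_power (J : Type) (a : 'I_1 -> power (powerset_top 'I_n.+1) J)
    (KP : K (power (powerset_top 'I_n.+1) J)) :
  pfun_of size_formula (Member KP) a = Some (fun j => exact_size (a ord0 j)).
Proof. exact/size_pfunP/sat_size_formula_power. Qed.

(** For extendability, each algebra embeds by evaluation into a power of the powerset algebra, where
    the operation is total. *)
Lemma ext_pp_size : ext_pp (pfun_of size_formula : pfun K 1).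
Proof.
have pp := pp_exists_eqs heyting_size_equations.
split; first exact: pp_pfun_implicit functional_size_formula pp.
  move=> A a; pose D := powerset_top 'I_n.+1.
  have KP : K (power D {h : A -> D | homomorphism h}).
    by apply/generated_varietyE/models_eqs_power/models_eqs_refl.
  exists (Member KP), (@evaluation heyting A D); split.
    by apply: embedding_evaluation => x y; apply: variety_separated (memberP A).
  by eexists; apply: size_pfun_power.
by exists size_formula; split=> //; apply: pfun_ofP functional_size_formula.
Qed.
End HeytingSizeFormula.

Section SizedCompanion.
Variable n : nat.
Local Notation P := (powerset_top 'I_n.+1).
Local Notation K := (generated_variety P).
Local Notation sz := (@has_size n).
Local Notation ar := (fun _ : 'I_n => 1).
Local Notation L := (expand heyting ar).
Local Notation D := (pt_alg sz 'I_n.+1).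

Definition size_index (i : 'I_n) : 'I_n.+1 := widen_ord (leqnSn n) i.

Definition size_family (i : 'I_n) : pfun K 1 :=
  pfun_of (size_formula (size_index i)).

Definition size_companion : class L := subalgebras (expansions size_family).

Lemma sizedE (i : 'I_n) (x : pt_carrier 'I_n.+1) :
  sized sz i x = exact_size (size_index i) x.
Proof.
case: x => // X; rewrite /sized /exact_size; case: pselect => /= [/has_sizeE->|].
  by rewrite eqxx.
by case: eqP => // XE; case; apply/has_sizeE.
Qed.

Lemma size_familyP (A : algebra L) (KA : K (reduct A)) :
  (forall i a, size_family i (A := Member KA) a = Some (op A (inr i) a)) <->
  (forall i (a : 'I_1 -> A), sat (A := reduct A)
    (extend (a : 'I_1 -> reduct A) (op A (inr i) a)) (size_formula (size_index i))).
Proof.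
by split=> H i a; apply/(@size_pfunP _ (size_index i) (Member KA)); apply: H.
Qed.

Lemma power_expansion (J : Type) : expansions size_family (power D J).
Proof.
have KP : K (reduct (power D J)).
  apply/generated_varietyE.
  exact: (@models_eqs_power heyting P P J (@models_eqs_refl _ P)).
exists KP => i a; rewrite /size_family.
rewrite [LHS](@size_pfun_power n (size_index i) J a KP); congr Some.
by apply: funext => j; rewrite -sizedE.
Qed.

(** In an expansion, Heyting homomorphisms to [D] preserve the new operations, which are defined by
    pp formulas, so separation holds in the larger language. Conversely, representation embeds [A]
    into a power of [D]. *)
Lemma size_companionE (A : algebra L) : size_companion A <-> models_eqs_of D A.
Proof.
split=> [[C [h [[KC /size_familyP HC] hemb]]]|DA].
  apply: models_eqs_embedding hemb _; apply: models_eqs_separated => x y xy.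
  have [g gh gxy] := variety_separated KC xy.
  exists D, g; split=> // -[s|i] a; first exact: gh.
  have := pp_formula_hom gh (pp_exists_eqs _) (HC i a).
  by rewrite extend_comp sat_size_formula -sizedE.
exists (power D {h : A -> D | homomorphism h}), (@evaluation L A D).
split; first exact: power_expansion.
apply: embedding_evaluation => x y; apply: finite_representation DA.
exact: has_size_set0.
Qed.

Lemma size_family_pp : pp_family size_family.
Proof.
split=> [i|i j /= ij]; first exact: ext_pp_size.
have KD : K (power P unit).
  by apply/generated_varietyE/models_eqs_power/models_eqs_refl.
(* An initial segment of k + 1 points tells the operation of index k from all others. *)
pose x (k : 'I_n) : pt_carrier 'I_n.+1 :=
  Some [set l : 'I_n.+1 | l <= size_index k].
have xE (k l : 'I_n) :
    exact_size (size_index l) (x k) = if k == l then Some setT else None.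
  rewrite /exact_size /x; have -> : set_card [set l : 'I_n.+1 | l <= size_index k] = k.+1.
    rewrite -[RHS](card_prefix (size_index k)).
    by apply: eq_card => p; rewrite !inE asboolb.
  by rewrite eqSS.
(* Feeding a constant tuple works at every arity, so the equality of dependent pairs can be used
   without inverting it. *)
pose Phi (s : {k & pfun K k}) : Prop :=
  tagged s (Member KD) (fun _ _ => x i) = Some (fun=> Some setT).
have : Phi (existT (pfun K) 1 (size_family i)) =
       Phi (existT (pfun K) 1 (size_family j)) by rewrite ij.
rewrite /Phi /= /size_family !size_pfun_power !xE eqxx => E.
have : Some (fun=> if i == j then Some setT else None) =
    Some (fun=> Some setT) :> option (power P unit) by rewrite -E.
by case=> /(congr1 (@^~ tt)); case: eqP.
Qed.

(** The new operations themselves are the probes: each nonempty proper set is recognized by the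
    operation of its size. *)
Lemma size_companion_Beth : Beth_companion K size_companion.
Proof.
split; first by exists size_family; split=> //; apply: size_family_pp.
pose probe (i : 'I_n) : term L unit := @App L unit (inr i) (fun=> Var L tt).
apply: (@finite_strong_Beth _ sz (@has_size_set0 n) n n probe).
- move=> f fI i X; rewrite !has_sizeE; suff -> : set_card (f @^-1` X) = set_card X by [].
  rewrite /set_card -[RHS](card_preimset _ fI); apply: eq_card => p.
  by rewrite !inE.
- move=> X [p Xp] [q Xq].
  have X_gt0 : 0 < set_card X by apply/card_gt0P; exists p; rewrite inE; apply/asboolP.
  have X_lt : (set_card X).-1 < n.
    rewrite -ltnS prednK // -[X in _ < X]card_ord -cardsT.
    apply: proper_card; rewrite properT; apply/eqP => XT.
    by have := finset.in_setT q; rewrite -XT inE => /asboolP.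
  exists (Ordinal X_lt).
    rewrite /probed /= /sized; case: pselect => //; case.
    by apply/has_sizeE; rewrite /= prednK.
  move=> X'; rewrite /probed /= /regularization; case: pselect => //= _.
  by rewrite /sized; case: pselect => // /has_sizeE -> _; rewrite prednK.
- by move=> A /size_companionE.
- exact/size_companionE/models_eqs_refl.
Qed.

(* The identity ((x <-> y) <= (f x <-> f y)) makes every Heyting congruence
   compatible with f. *)
Lemma size_compatible (A : algebra L) (i : 'I_n) (x y : A) :
  models_eqs_of D A ->
  bmeet (op A (inr i) (fun=> x)) (bmeet (bimp x y) (bimp y x)) =
  bmeet (op A (inr i) (fun=> y)) (bmeet (bimp x y) (bimp y x)).
Proof.
move=> DA; pose f z : term L A := @App L A (inr i) (fun=> Var L z).
have /(pt_identity DA) : forall e : A -> D,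
    eval e (tmeet (f x) (tiff (Var L x) (Var L y))) =
    eval e (tmeet (f y) (tiff (Var L x) (Var L y))).
  move=> e; apply: force_ext => -[p|];
    rewrite (force_eval_meet _ _ (f x)) (force_eval_meet _ _ (f y)).
    have fT z : force (Some p) (eval e (f z)) = True by apply: force_sized_leaf.
    by rewrite !fT.
  by rewrite force_tiff /=; split=> -[+ xy]; rewrite xy.
by rewrite !eval_meet !eval_imp.
Qed.

(** If x and y are congruent then x <-> y is congruent to 1, so meeting with it changes no class and
    [size_compatible] applies. The quotient is in the class as a homomorphic image. *)
Lemma size_companion_congruence_preserving :
  congruence_preserving K size_companion.
Proof.
move=> A /size_companionE DA r; split=> -[[rE rop] Mr].
  split; first by split=> // s; apply: (rop (inl s)).
  apply/generated_varietyE; move/size_companionE: Mr.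
  exact: (@models_eqs_reduct _ _ D (quotient r)).
have [rr rs rt] := rE.
have cong : congruence r.
  split=> // -[s|i]; first exact: rop.
  move=> a b ab; rewrite (ord1_eta a) (ord1_eta b); move: (ab ord0).
  move: (a ord0) (b ord0) => x y xy.
  have rmeet z z' w w' : r z z' -> r w w' -> r (bmeet z w) (bmeet z' w').
    by move=> zz' ww'; apply: (rop Meet) => l; rewrite /two; case: ifP.
  have rimp z z' w w' : r z z' -> r w w' -> r (bimp z w) (bimp z' w').
    by move=> zz' ww'; apply: (rop Imp) => l; rewrite /two; case: ifP.
  have rtop : r (bmeet (bimp x y) (bimp y x)) (btop A).
    rewrite -(biff_refl DA x); apply: rmeet; apply: rimp => //; exact: rs.
  have step z : r (bmeet z (bmeet (bimp x y) (bimp y x))) z.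
    by rewrite -[X in r _ X](bmeet_top DA); apply: rmeet.
  apply: rt (rs _ _ (step _)) _; rewrite size_compatible //; exact: step.
split=> //; apply/size_companionE; apply: models_eqs_image DA.
  exact: (quotient_class_hom cong).
exact: quotient_class_surj.
Qed.
End SizedCompanion.

(** * No simple companion above width two *)

Lemma powerset_top_pullback_hom (T T' : Type) (f : T' -> T) :
  (forall q, exists p, f p = q) ->
  homomorphism (pullback f : powerset_top T -> powerset_top T').
Proof.
move=> fsurj; have nos (i : void) X : no_size i (f @^-1` X) <-> no_size i X by [].
have fh := pullback_hom fsurj nos.
by move=> s a; apply: (fh (inl s) a).
Qed.

Lemma pullback_inj (T T' : Type) (f : T' -> T) : (forall q, exists p, f p = q) ->
  injective (pullback f).
Proof.
move=> fsurj x y xy; apply: force_ext => w.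
have [w' <-] : exists w', omap f w' = w.
  by case: w => [q|]; [have [p <-] := fsurj q; exists (Some p)|exists None].
by rewrite -!force_pullback xy.
Qed.

(** * Endomorphisms of a finite powerset algebra *)

Section Endomorphisms.
Variable T : finType.
Local Notation P := (powerset_top T).
Implicit Type g : P -> P.

(** The full set is the largest element below 1. If distinct x and y are identified, x <-> y lies
    below the full set and is sent to 1. *)
Lemma endomorphism_inj g :
  homomorphism g -> g (Some setT) <> None -> injective g.
Proof.
move=> gh gk x y gxy; apply: contrapT => xy; apply: gk.
have gh0 : homomorphism (g : pt_alg no_size T -> pt_alg no_size T).
  by case=> // s; apply: gh.
pose c : pt_alg no_size T :=
  bmeet (B := pt_alg no_size T) (bimp (B := pt_alg no_size T) x y)
    (bimp (B := pt_alg no_size T) y x).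
have gc : g c = None by rewrite -force_rootE; apply/(hom_biff _ _ gh0).
have cN : ~ force None c by move/(hom_biff (h := id) x y (fun _ _ => erefl)).
have ck : pt_meet c (Some setT) = c.
  apply: force_ext => -[p|]; rewrite force_meet; first by rewrite force_full; tauto.
  by split=> [[]|/cN].
have := gh Meet (two c (Some setT)); rewrite /= ck gc => /(congr1 (force None)).
rewrite force_meet force_top /= => E; rewrite -force_rootE.
by have [] : True /\ force None (g (Some setT)) by rewrite -E.
Qed.

(** Encoding the carrier by the finite type [option {set T}] makes an injective endomorphism
    bijective. *)
Lemma endomorphism_inverse g : homomorphism g -> injective g ->
  exists2 h : P -> P, homomorphism h & cancel g h.
Proof.
move=> gh g_inj.
pose enc : P -> option {set T} := omap (fun X => [set p | `[< X p >]]%SET).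
pose dec : option {set T} -> P := 
    omap (fun (S : {set T}) p => is_true (p \in S)).
have encK : cancel enc dec.
  case=> // X; congr Some; apply/seteqP; split=> p /=.
    by rewrite inE => /asboolP.
  by rewrite inE => Xp; apply/asboolP.
have decK : cancel dec enc.
  case=> // S; congr Some; apply/setP => p; rewrite inE /=.
  by apply/asboolP/idP.
have [h' gh' h'g] : bijective (enc \o g \o dec).
  apply: injF_bij => S S' /(can_inj encK)/g_inj; exact: (can_inj decK).
have hg x : dec (h' (enc (g x))) = x.
  by have := gh' (enc x); rewrite /= encK => ->; rewrite encK.
have gh'' x : g (dec (h' (enc x))) = x.
  by apply: (can_inj encK); apply: h'g.
exists (dec \o h' \o enc) => // s a; apply: g_inj.
rewrite /= gh'' gh; congr (op P s); apply: funext => i; by rewrite /= gh''.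
Qed.
End Endomorphisms.

Section NoSimpleCompanion.
Variable n : nat.
Hypothesis n_gt1 : 1 < n.
Local Notation P := (powerset_top 'I_n.+1).
Local Notation K := (generated_variety P).
Variables (I : Type) (ar : I -> nat) (M : class (expand heyting ar)).
Variable F : forall i, pfun K (ar i).
Hypothesis F_pp : forall i, ext_pp (@F i).
Hypothesis M_F : M = expansions F.
Hypothesis M_sub : forall (A B : algebra (expand heyting ar)) (h : A -> B),
  embedding h -> M B -> M A.

Let KP : K P. Proof. exact/generated_varietyE/models_eqs_refl. Qed.

(** Let [f] be defined at [a] in an extension [B] of [P]. A homomorphism from [B] to [P] separating
    T from 1 restricts to an automorphism of [P], whose inverse brings the value back to [a]. *)
Lemma ext_pp_total (k : nat) (f : pfun K k) (a : 'I_k -> P) :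
  ext_pp f -> exists b, f (Member KP) a = Some b.
Proof.
move=> [[_ _ fP] fext _].
have [B [h [[hh hI] [b fb]]]] := fext (Member KP) a.
have [|g gh gne] :=
    @variety_separated n.+1 B (h (Some setT)) (h None) (memberP B).
  by move/hI.
have ghh : homomorphism (g \o h : P -> P) by apply: hom_comp.
have ghN : g (h None) = None by apply: (ghh Top (@nullary _)).
have [h' hh' h'K] := endomorphism_inverse ghh
  (endomorphism_inj ghh (fun E => gne (etrans E (esym ghN)))).
have fg := fP _ (Member KP) _ gh _ _ fb.
have := fP (Member KP) (Member KP) h' hh' _ _ fg.
have -> : (fun i => h' (g (h (a i)))) = a by apply: funext => i; apply: h'K.
by exists (h' (g b)).
Qed.

Definition expanded_powerset : algebra (expand heyting ar) :=
  @Algebra (expand heyting ar) P (fun s =>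
    match s return ('I_(@arity (expand heyting ar) s) -> P) -> P with
    | inl s => @op _ P s
    | inr i => fun a => projT1 (cid (ext_pp_total a (F_pp i)))
    end).
Local Notation P' := expanded_powerset.

Lemma expanded_powersetE i (a : 'I_(ar i) -> P) :
  @F i (Member KP) a = Some (op P' (inr i) a).
Proof. exact: projT2 (cid (ext_pp_total a (F_pp i))). Qed.

(** The pp definitions hold coordinatewise, so they determine the operations of the power. *)
Lemma expanded_power (J : Type) : M (power P' J).
Proof.
have KJ : K (reduct (power P' J)).
  apply/generated_varietyE.
  exact: (@models_eqs_power heyting P P J (@models_eqs_refl _ P)).
rewrite M_F; exists KJ => i a; have [_ _ [p [pp pF]]] := F_pp i.
apply/(pF (Member KJ)); apply: (pp_formula_power (D := P) (J := J)) => // j.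
have /(pF (Member KP)) := expanded_powersetE (fun l => a l j).
by congr sat; apply: funext => -[].
Qed.

(** Pullback along this map embeds [powerset_top bool] as {0, {p}, T - {p}, T, 1} with p =
    [ord0]. *)
Definition is_ord0 (q : 'I_n.+1) := q == ord0.
Local Notation Q := (powerset_top bool).
Local Notation inc := (@pullback bool 'I_n.+1 is_ord0).

Lemma is_ord0_surj c : exists q, is_ord0 q = c.
Proof.
case: c; [by exists ord0|exists ord_max].
by apply/eqP => /(congr1 val) /= E; move: n_gt1; rewrite E.
Qed.

Lemma inc_hom : homomorphism (inc : Q -> P).
Proof. exact: powerset_top_pullback_hom is_ord0_surj. Qed.

(* The operations commute with the permutations of the points other than
   [ord0], hence preserve the subsets which do not separate these points. *)
Lemma inc_closed i (a : 'I_(ar i) -> Q) :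
  exists c : Q, inc c = op P' (inr i) (fun l => inc (a l)).
Proof.
have [[_ _ FP] _ _] := F_pp i; set b := op P' _ _.
have Fb : @F i (Member KP) (fun l => inc (a l)) = Some b.
  exact: expanded_powersetE.
have b_sym q q' : is_ord0 q = is_ord0 q' -> force (Some q) b -> force (Some q') b.
  (* The transposition of [q] and [q'] fixes every [inc (a l)], hence fixes [b]. *)
  move=> qq' Hq; pose f r := if r == q then q' else if r == q' then q else r.
  have ff r : f (f r) = r.
    rewrite /f; case: (eqVneq r q) => [->|rq].
      by case: (eqVneq q' q) => [->|_]; rewrite ?eqxx.
    by case: (eqVneq r q') => [->|rq']; rewrite ?eqxx // (negbTE rq) (negbTE rq').
  have fsurj r : exists r', f r' = r by exists (f r).
  have := FP (Member KP) (Member KP) (pullback f)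
    (powerset_top_pullback_hom fsurj) _ _ Fb.
  have -> : (fun l => pullback f (inc (a l))) = (fun l => inc (a l)).
    apply: funext => l; apply: force_ext => w; rewrite !force_pullback.
    have -> // : omap is_ord0 (omap f w) = omap is_ord0 w.
    case: w => //= r; congr Some; rewrite /f.
    by case: eqP => [->|_]; [|case: eqP => [->|]].
  rewrite Fb => -[bE]; rewrite bE force_pullback /= /f eqxx.
  by case: eqP => [->|].
exists (omap (fun X => [set c | exists2 q, is_ord0 q = c & X q]) b).
apply: force_ext => w; rewrite force_pullback.
case: b b_sym {Fb} => [X|] //= b_sym; case: w => //= q.
by split=> [[q' qq' Xq']|Xq]; [apply: (b_sym q' q)|exists q].
Qed.

Definition two_point_algebra : algebra (expand heyting ar) :=
  @Algebra (expand heyting ar) Q (fun s =>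
    match s return ('I_(@arity (expand heyting ar) s) -> Q) -> Q with
    | inl s => @op _ Q s
    | inr i => fun a => projT1 (cid (inc_closed a))
    end).
Local Notation Q' := two_point_algebra.

Lemma inc_embedding : embedding (inc : Q' -> P').
Proof.
split; last exact: pullback_inj is_ord0_surj.
case=> [s|i] a; first exact: (inc_hom (s := s) a).
exact: (projT2 (cid (inc_closed a))).
Qed.

(** This is where simplicity enters: [Q'] belongs to [M], so its new operations are the [F i] of its
    Heyting reduct, and every Heyting automorphism preserves these. *)
Lemma swap_hom : homomorphism (pullback negb : Q' -> Q').
Proof.
have nsurj c : exists c', ~~ c' = c by exists (~~ c); rewrite negbK.
have nh := powerset_top_pullback_hom nsurj.
have MP : M P'.
  have [K1 F1] : expansions F P'.
    by exists KP => i a; apply: expanded_powersetE.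
  by rewrite M_F; exists K1.
have : M Q' by apply: M_sub inc_embedding MP.
rewrite M_F => -[KQ FQ]; case=> [s|i] a; first exact: (nh s a).
have [[_ _ FP] _ _] := F_pp i.
have := FP (Member KQ) (Member KQ) _ nh _ _ (FQ i a).
by rewrite (FQ i) => -[].
Qed.

Lemma not_strong_Beth : ~ strong_Beth M.
Proof.
(* The index [ord0] stands for size 1: the formula recognizes singletons. *)
pose fml := expanded_size_formula (ord0 : 'I_n.+1) ar.
have M_reduct A : M A -> K (reduct A) by rewrite M_F => -[].
have fun_fml : functional M fml.
  move=> A /M_reduct KA a b b' /sat_expanded_size_formula Hb.
  move=> /sat_expanded_size_formula; exact: (functional_size_formula KA).
have imp : implicit_operation (pfun_of fml : pfun M 1).
  by apply: pp_pfun_implicit => //; apply: pp_exists_eqs.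
move=> /(_ _ _ imp)[Ts HT].
pose alpha (c : bool) : Q' := Some [set d | d = c].
pose B := Member (expanded_power bool).
pose a (_ : 'I_1) : B := fun c => inc (alpha c).
pose b : B := fun c => exact_size ord0 (inc (alpha c)).
have [|t _ bt] := HT B a b.
  apply/(pfun_ofP fun_fml)/sat_expanded_size_formula.
  exact: (@sat_size_formula_power n ord0 bool a).
have bE c : b c = inc (eval (fun=> alpha c) t).
  by rewrite bt eval_power (hom_eval _ _ inc_embedding.1).
have b_true : b true = Some setT.
  rewrite /b /exact_size /=; case: eqP => // -[].
  rewrite -[RHS](cards1 (ord0 : 'I_n.+1)); apply: eq_card => q; rewrite !inE.
  by apply/asboolP/idP.
(* The complement of the point has n points, and n > 1. *)
have b_false : b false = None.
  rewrite /b /exact_size /=; case: eqP => // E; exfalso; move: E.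
  have -> : set_card (is_ord0 @^-1` [set d | d = false]) =
      #|~: [set ord0 : 'I_n.+1]%SET|.
    by apply: eq_card => q; rewrite !inE;
      apply/asboolP/idP => /= [/negbT|/negbTE].
  have := cardsC [set ord0 : 'I_n.+1]%SET; rewrite cards1 card_ord add1n => -[->].
  by move=> n1; move: n_gt1; rewrite n1.
have swap_alpha : (fun _ : 'I_1 => alpha false) = pullback negb \o (fun=> alpha true).
  by apply: funext => i; congr Some; apply/seteqP; split=> -[].
have : force None (b false) by rewrite b_false.
(* The swap forces a term with value 1 at [alpha false] to have value 1 at [alpha true] as well. *)
rewrite bE swap_alpha -(hom_eval _ _ swap_hom) !force_pullback => H.
have : force None (b true) by rewrite bE force_pullback.
by rewrite b_true.
Qed.
End NoSimpleCompanion.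

Lemma subalgebras_embedding (L : language) (C : class L) (A B : algebra L)
    (h : A -> B) : embedding h -> subalgebras C B -> subalgebras C A.
Proof.
move=> [hh hI] [E [g [CE [gh gI]]]]; exists E, (g \o h); split=> //.
by split; [apply: hom_comp|apply: inj_comp].
Qed.

(** Being a pp expansion makes [M] closed under subalgebras; simplicity describes it by a possibly
    different family [F]. *)
Lemma no_simple_companion (n : nat) (I : Type) (ar : I -> nat)
    (M : class (expand heyting ar)) : 1 < n ->
  ~ simple_Beth_companion (generated_variety (powerset_top 'I_n.+1)) M.
Proof.
move=> n1 [[[F1 [_ MF1]] SB] [_ [F [[F_pp _] MF]]]].
apply: (not_strong_Beth n1 F_pp MF _ SB) => A B h hemb.
by rewrite MF1; apply: subalgebras_embedding hemb.
Qed.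

Lemma unexpanded_companion (T : Type) : strong_Beth (@reduct_class T) ->
  exists (I : Type) (ar : I -> nat) (M : class (expand heyting ar)),
    simple_Beth_companion (generated_variety (powerset_top T)) M /\
    congruence_preserving (generated_variety (powerset_top T)) M.
Proof.
move=> SB; exists void, (fun=> 1), (@reduct_class T).
split; first exact: reduct_class_simple.
exact: reduct_class_congruence_preserving.
Qed.

Lemma unexpanded_strong_Beth (k : nat_or_omega) :
  k = Fin 0 \/ k = Fin 1 \/ k = Fin 2 \/ k = Omega ->
  exists T : Type, A_ k = powerset_top T /\ strong_Beth (@reduct_class T).
Proof.
have noI : void -> False by [].
case=> [|[|[]]] ->; eexists; split=> //.
- by apply: (boolean_strong_Beth noI) => A; apply: reduct_varietyE.
- by apply: (small_strong_Beth noI (n := 0)) => // A; apply: reduct_varietyE.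
- by apply: (small_strong_Beth noI (n := 1)) => // A; apply: reduct_varietyE.
- by apply: (omega_strong_Beth noI) => A; apply: reduct_varietyE.
Qed.

Theorem theorem3p2 (k : nat_or_omega) :
  (exists (I : Type) (ar : I -> nat) (M : class (expand heyting ar)),
      Beth_companion (generated_variety (A_ k)) M /\
      congruence_preserving (generated_variety (A_ k)) M) /\
  ((exists (I : Type) (ar : I -> nat) (M : class (expand heyting ar)),
      simple_Beth_companion (generated_variety (A_ k)) M) <->
   k = Fin 0 \/ k = Fin 1 \/ k = Fin 2 \/ k = Omega).
Proof.
have [small|large] := pselect (k = Fin 0 \/ k = Fin 1 \/ k = Fin 2 \/ k = Omega).
  have [T [-> /unexpanded_companion[I [ar [M [MB Mcp]]]]]] :=
    unexpanded_strong_Beth small.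
  split; first by exists I, ar, M; split=> //; case: MB.
  by split=> // _; exists I, ar, M.
case: k large => [[|[|[|n]]]|] large; try by case: large; tauto.
split.
  (* Here k = n + 3, and the sizes to be recognized are 1, ..., n + 2. *)
  exists 'I_n.+2, (fun=> 1), (@size_companion n.+2).
  split; first exact: size_companion_Beth.
  exact: size_companion_congruence_preserving.
split=> // -[I [ar [M MB]]]; exfalso.
exact: (@no_simple_companion n.+2 I ar M isT MB).
Qed.
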